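(* Let $p\in[1,\infty]$, let $q$ be defined by $1/p+1/q=1$, and assume $p\ge q$. Let $h\in C^1([0,\infty))\cap L^\infty(\mathbb R_+)$ satisfy $h(0)=0$, $h'(0)>0$, $h(x)>0$ for all $x>0$ and $\liminf_{x\to\infty}h(x)>0$. Let $u$ be compactly supported in $[0,\infty)$ and assume that, for some $\sigma<\alpha-1/p$, one has $h^\sigma D_\alpha u\in L^p(\mathbb R_+)$ and $h^{\sigma_1}u\in L^q(\mathbb R_+)$ for some $\sigma_1$ with $\sigma\le\sigma_1\le\alpha-1/q$. Then $h^\sigma u\in L^p(\mathbb R_+)$ and $$\|h^\sigma u\|_{L^p}\le C\,\|h^\sigma D_\alpha u\|_{L^p},$$ where $C$ depends only on $h,p,\alpha,\sigma$ and on a number $X>0$ such that $\operatorname{supp}u\subset[0,X]$.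
   Context: $\mathbb R_+=(0,\infty)$, $1/\infty=0$; $\alpha,\sigma,\sigma_1$ are real numbers. $D_\alpha u:=h\,\partial_xu+\alpha h'u=h^{1-\alpha}\partial_x(h^\alpha u)$, derivatives of the locally integrable function $u$ on $(0,\infty)$ being taken in the sense of distributions. *)

(* Defs.v *)
From HB Require Import structures.
From mathcomp Require Import all_boot all_order all_algebra.
From mathcomp Require Import all_classical all_reals all_analysis.

Set Implicit Arguments.
Unset Strict Implicit.
Unset Printing Implicit Defensive.

Import Order.TTheory GRing.Theory Num.Theory.
Import numFieldNormedType.Exports.

Local Open Scope classical_set_scope.
Local Open Scope ring_scope.

Section Definitions.
Context {R : realType}.
Implicit Types (A D : set R) (f g h u phi : R -> R).

Local Notation mu := (@lebesgue_measure R).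

Definition Rpos : set R := `]0, +oo[.

(* Only the values of f on A matter, so at a boundary point of an interval A
   this is the one-sided derivative. *)
Definition quotient_within A f (x : R) : set_system R :=
  (fun y => (f y - f x) / (y - x)) @ within A x^'.

Definition derive1_within A f (x : R) : R := lim (quotient_within A f x).

Definition C1_on A f : Prop :=
  (forall x, A x -> cvg (quotient_within A f x)) /\
  {within A, continuous (derive1_within A f)}.

(* L^p and its norm over (0, oo): functions are extended by zero, so their
   values outside (0, oo) are irrelevant. *)
Definition Lp_Rpos (p : \bar R) f : Prop := f \_ Rpos \in Lfun mu p.

Definition normp_Rpos (p : \bar R) f : \bar R :=
  ('N[mu]_p[EFin \o (f \_ Rpos)])%E.

(* Support of the a.e. class of u on D; it is a subset of the closure of D. *)
Definition ess_support D u : set R :=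
  [set x | forall V, nbhs x V -> ~ {ae mu, forall y, D y -> V y -> u y = 0}].

Definition test_function D phi : Prop :=
  [/\ forall n x, derivable (derive1n n phi) x 1,
      compact (closure [set x | phi x != 0]) &
      closure [set x | phi x != 0] `<=` D].

(* The distribution h * u' + alpha h' u on (0, oo). As h is only C^1, the
   product h * u' acts by <h u', phi> = <u', h phi> = - int u (h phi)',
   which is meaningful because h phi is C^1 with compact support. *)
Definition Dalpha h (alpha : R) u phi : R :=
  - (\int[mu]_(x in Rpos) (u x * derive1 (h \* phi) x)) +
  alpha * \int[mu]_(x in Rpos) (derive1 h x * u x * phi x).

Definition Dalpha_is h (alpha : R) u g : Prop :=
  locally_integrable Rpos g /\
  forall phi, test_function Rpos phi ->
    Dalpha h alpha u phi = \int[mu]_(x in Rpos) (g x * phi x).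

Definition weighted h (s : R) f : R -> R := fun x => h x `^ s * f x.

End Definitions.

(* Main.v *)
Require Import Defs.
From mathcomp Require Import all_boot all_order all_algebra.
From mathcomp Require Import all_classical all_reals all_analysis.
From mathcomp Require Import measurable_realfun ess_sup_inf lra ring.

Import Order.TTheory GRing.Theory Num.Theory.
Import numFieldNormedType.Exports.

Local Open Scope classical_set_scope.
Local Open Scope ring_scope.

(** On bounded intervals the equation, of first order, degenerates only at [0].  Put
    [v = h^alpha u]; formally [D_alpha u = h^(1-alpha) v'], so that
    [v' = h^(alpha-1) g] when [g] is the distribution [D_alpha u].

    Integrating.  As [h] is only C^1, [h^(alpha-1) phi] is not a test function
    and the identity for [v'] cannot be read off the definition.  What can be
    read off is that [w = h u] has the distributional derivative
    [k = g + (1-alpha) h' u] ([Dalpha_weak_derivative]).  Testing against smooth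
    approximations of the indicator of [ ]a, b] ] gives [w b - w a] as the
    integral of [k] for all Lebesgue points [a < b] of [w]
    ([weak_derivative_FTC]), and the product rule for the absolutely continuous
    function [w] and the C^1 function [h^(alpha-1)] ([FTC_product_rule]) turns
    this into the formula for the increments of [v] ([Dalpha_FTC]): the terms
    with [h' u] cancel.

    Vanishing at the origin.  On [ ]0, X] ] the function [h] is comparable to
    the identity, since [h 0 = 0] and [h' 0 > 0] ([C1_on_comparable]).  With
    [s = alpha - sigma > 1/p] and [G = h^sigma g], the increment of [v] on
    [ ]a, x] ] is at most a constant times
    [A x = int_0^x t^(s-1) |G t| dt].  If [|v x|] exceeded that bound, [|v|]
    would be bounded away from [0] on [ ]0, x[ ], and [|h^sigma1 u|^q] would be
    at least a multiple of [1/t] there because [(alpha - sigma1) q >= 1]; this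
    contradicts [h^sigma1 u] being in [L^q]
    ([integrable_not_bounded_below]).  Hence [|v x|] is bounded by a multiple
    of [A x], with no term from [0].

    Hardy.  Dividing by [h^s], [|h^sigma u|] is bounded on [ ]0, X] ] by a
    multiple of [x^(-s) A x], and almost everywhere beyond [X] it is [0]
    ([ess_support_null]).  The weighted Hardy inequality ([hardy]), valid for
    [s > 1/p], bounds the norm of [x^(-s) A x] by that of [G]. *)

(** * Smooth functions and a smooth step *)

Section SmoothFunctions.
Context {R : realType}.
Implicit Types (f g : R -> R) (x : R).

Definition smooth f := forall n x, derivable (derive1n n f) x 1.

(** Coinduction: a class stable under differentiation is smooth, whence no
    iterated derivative ever has to be computed. *)
Lemma smooth_coind (C : (R -> R) -> Prop) :
  (forall f, C f -> (forall x, derivable f x 1) /\ C (derive1 f)) ->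
  forall f, C f -> smooth f.
Proof.
move=> CD f Cf n x; suff Cn : C (derive1n n f) by have [] := CD _ Cn.
by elim: n => [//|n /CD[]]; rewrite derive1nS.
Qed.

Lemma derive1nSr n f : derive1n n.+1 f = derive1n n (derive1 f).
Proof. by elim: n => [|n IH]; rewrite ?derive1n1// derive1nS IH derive1nS. Qed.

Lemma smooth_derive1 f : smooth f -> smooth (derive1 f).
Proof. by move=> sf n x; rewrite -derive1nSr; exact: sf. Qed.

Lemma smooth_continuous f : smooth f -> continuous f.
Proof.
by move=> sf x; apply/differentiable_continuous/derivable1_diffP/(sf 0%N).
Qed.

Lemma smooth_antiderivative f g : (forall x, is_derive x 1 f (g x)) ->
  smooth g -> smooth f.
Proof.
move=> fg sg.
have f'E : derive1 f = g.
  by apply/funext => x; rewrite derive1E; exact: derive_val.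
by case=> [|n] x; rewrite ?derive1n0// derive1nSr f'E; exact: sg.
Qed.

Lemma is_derive_cvg f a d :
  h^-1 * (f (h + a) - f a) @[h --> 0^'] --> d -> is_derive a 1 f d.
Proof.
move=> fd; have fd' : h^-1 *: (f (h *: 1 + a) - f a) @[h --> 0^'] --> d.
  by under eq_fun do rewrite [_ *: 1]mulr1.
by apply: DeriveDef; [apply/cvg_ex; exists d|exact/cvg_lim].
Qed.

Lemma is_derive_quadratic f a K : (forall x, `|f x| <= K * (x - a) ^+ 2) ->
  is_derive a 1 f 0.
Proof.
move=> fK.
have fa : f a = 0.
  by apply/eqP; rewrite -normr_le0 (le_trans (fK a))// subrr expr0n mulr0.
apply: is_derive_cvg; apply/cvgr0Pnorm_le => e e0.
have K0 : 0 <= K.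
  have := le_trans (normr_ge0 _) (fK (a + 1)).
  by rewrite addrAC subrr add0r expr1n mulr1.
near=> h.
have h0 : h != 0 by near: h; exact: nbhs_dnbhs_neq.
rewrite fa subr0 normrM normfV ler_pdivrMl ?normr_gt0//.
rewrite (le_trans (fK _))// addrK -real_normK ?num_real// expr2 mulrCA.
rewrite ler_wpM2l//.
have he : `|h| <= e / (K + 1) by near: h; apply: dnbhs0_le; rewrite divr_gt0 ?ltr_wpDl.
rewrite (le_trans (ler_wpM2l K0 he))// mulrA ler_pdivrMr ?ltr_wpDl//.
by rewrite mulrC ler_wpM2l ?lerDl// ltW.
Unshelve. all: by end_near. Qed.

Let t x : R := x * (1 - x).

(** A family stable under differentiation that contains the bump
    [exp (- 1 / (x (1 - x)))] on [ ]0, 1[ ]: the derivative only changes the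
    polynomial and the power of [1 / (x (1 - x))]. *)
Definition flat_fun (p : {poly R}) m x : R :=
  if 0 < x < 1 then p.[x] * (t x)^-1 ^+ m * expR (- (t x)^-1) else 0.

Let expr_expRN m (y : R) : 0 < y ->
  y ^+ m * expR (- y) <= (m.+2)`!%:R / y ^+ 2.
Proof.
move=> y0; rewrite expRN ler_pdivrMr ?expR_gt0// mulrAC ler_pdivlMr ?exprn_gt0//.
(* one term of the exponential series, two degrees above [m] *)
have := expR_ge1Dxn m.+1 (ltW y0).
rewrite -exprD addn2 => h.
rewrite mulrC -ler_pdivrMr ?ltr0n ?fact_gt0//.
by rewrite (le_trans _ h)// lerDr.
Qed.

(** The exponential beats every power of [1 / (x (1 - x))]; this quadratic bound
    is what makes the derivative exist, and vanish, at the endpoints. *)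
Lemma flat_fun_quadratic p m :
  exists K, forall x, (`|flat_fun p m x| <= K * (x - 0) ^+ 2) /\
                      (`|flat_fun p m x| <= K * (x - 1) ^+ 2).
Proof.
have [c _ pc] : exists2 c, c \in `[0, 1]%R &
    forall x, x \in `[0, 1]%R -> `|p.[x]| <= `|p.[c]|.
  apply: EVT_max => //; apply: continuous_subspaceT => x.
  apply: (@continuous_comp _ _ _ (horner p) Num.norm); last exact: norm_continuous.
  exact: continuous_horner.
exists (`|p.[c]| * (m.+2)`!%:R) => x.
have K0 : 0 <= `|p.[c]| * (m.+2)`!%:R by rewrite mulr_ge0.
rewrite /flat_fun; case: ifPn => [/andP[x0 x1]|_]; last first.
  by rewrite normr0; split; rewrite mulr_ge0// sqr_ge0.
have x1' : 0 < 1 - x by rewrite subr_gt0.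
have t0 : 0 < t x by rewrite /t mulr_gt0.
have h : `|p.[x] * (t x)^-1 ^+ m * expR (- (t x)^-1)|
   <= `|p.[c]| * (m.+2)`!%:R * t x ^+ 2.
  rewrite -mulrA normrM -mulrA ler_pM// ?pc// ?in_itv/= ?(ltW x0) ?(ltW x1)//.
  rewrite ger0_norm ?mulr_ge0 ?exprn_ge0 ?invr_ge0 ?(ltW t0) ?expR_ge0//.
  by rewrite (le_trans (expr_expRN _ _ _))// ?invr_gt0// exprVn invrK.
(* [x (1 - x)] is at most [x] and at most [1 - x]. *)
split; apply: (le_trans h); rewrite ler_wpM2l//.
  by rewrite subr0 lerXn2r ?nnegrE ?(ltW x0) ?(ltW t0)// ger_pMr// gerBl ltW.
rewrite -(sqrrN (x - 1)) opprB lerXn2r ?nnegrE ?(ltW x1') ?(ltW t0)//.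
by rewrite ger_pMl// ltW.
Qed.

Lemma flat_fun_derive p m : exists q n, forall x,
  is_derive x 1 (flat_fun p m) (flat_fun q n x).
Proof.
pose T : {poly R} := 'X * (1 - 'X).
pose D : {poly R} := 1 - 2%:P * 'X.
(* With [y = 1 / T] one has [y' = - y^2 D], so
   [(p y^m e^-y)' = (p' T^2 - m p T D + p D) y^(m+2) e^-y]. *)
pose q := deriv p * T ^+ 2 - m%:R%:P * p * T * D + p * D.
exists q, m.+2 => x.
have TE y : T.[y] = t y by rewrite /T !hornerE.
have DE y : D.[y] = 1 - 2 * y by rewrite /D !hornerE.
have [x01|] := boolP (0 < x < 1).
  apply: (@near_eq_is_derive _ _ _
     (fun y => p.[y] * (t y)^-1 ^+ m * expR (- (t y)^-1))).
    have : x \in `]0, 1[ by rewrite in_itv.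
    move=> /near_in_itvoo; apply: filterS => y.
    by rewrite in_itv/= /flat_fun => ->.
  have qE : q.[x] = p^`().[x] * t x ^+ 2 - m%:R * p.[x] * t x * (1 - 2 * x)
                    + p.[x] * (1 - 2 * x).
    by rewrite -DE -TE !expr2 /q !(hornerD, hornerN, hornerM, hornerC).
  have tn0 : t x != 0.
    by move/andP: x01 => [x0 x1]; rewrite /t mulf_neq0// ?gt_eqF// subr_gt0.
  have dt : is_derive x 1 t (1 - 2 * x).
    rewrite /t; apply: is_derive_eq.
    rewrite /GRing.scale/=; ring.
  have dV := is_deriveV tn0 dt.
  have dp := is_derive_poly p x.
  have dE : is_derive x 1 (fun y => expR (- (t y)^-1))
      (expR (- (t x)^-1) * (- (- t x ^- 2 *: (1 - 2 * x)))).
    exact: is_derive1_comp.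
  have dX := is_deriveX m dV; rewrite exprfctE in dX.
  have dM := is_deriveM (is_deriveM dp dX) dE.
  move: dM; set d := (X in is_derive _ _ _ X) => dM.
  suff <- : d = flat_fun q m.+2 x by exact: dM.
  rewrite /d /flat_fun x01 qE mulrfctE /GRing.scale/=.
  move: (expR _) => e; case: m {q qE dX d dM} => [|m].
    by rewrite !expr0 mul0r; field.
  by rewrite succnK !exprSr; move: (_ ^+ m) => z; field.
move=> nx01; rewrite [flat_fun q m.+2 x]/flat_fun (negPf nx01).
have [K fK] := flat_fun_quadratic p m.
have [xlt0|xge0] := ltP x 0.
  apply: (@near_eq_is_derive _ _ _ (cst (0 : R))). 
  have : x \in `]-oo, 0[ by rewrite in_itv.
  move=> /near_in_itvNyo; apply: filterS => y.
  by rewrite in_itv/= /flat_fun => y0; rewrite ltNge (ltW y0).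
have [xgt1|xle1] := ltP 1 x.
  apply: (@near_eq_is_derive _ _ _ (cst (0 : R))). 
  have : x \in `]1, +oo[ by rewrite in_itv/= xgt1.
  move=> /near_in_itvoy; apply: filterS => y.
  by rewrite in_itv/= andbT /flat_fun => y1; rewrite andbC ltNge (ltW y1).
move: nx01; rewrite !lt_neqAle xge0 xle1 !andbT negb_and !negbK => /orP[/eqP<-|/eqP->].
  by apply: (@is_derive_quadratic _ _ K) => y; have [] := fK y.
by apply: (@is_derive_quadratic _ _ K) => y; have [] := fK y.
Qed.

Lemma flat_fun_smooth p m : smooth (flat_fun p m).
Proof.
apply: (@smooth_coind (fun f => exists p m, f = flat_fun p m)); last by exists p, m.
move=> _ [p' [m' ->]]; have [q [n d]] := flat_fun_derive p' m'.
split=> [x|]; first by have [] := d x.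
by exists q, n; apply/funext => x; rewrite derive1E; exact: derive_val.
Qed.


Local Notation mu := (@lebesgue_measure R).

(** The normalized primitive of the bump [exp (- 1 / (x (1 - x)))]. *)
Lemma smooth_step : exists S : R -> R,
  [/\ smooth S, (forall x, x <= 0 -> S x = 0), (forall x, 1 <= x -> S x = 1),
      (forall x, 0 <= S x <= 1) & exists M, forall x, `|derive1 S x| <= M].
Proof.
pose B := flat_fun 1 0.
have BE x : B x = if 0 < x < 1 then expR (- (t x)^-1) else 0.
  by rewrite /B /flat_fun hornerC expr0 !mul1r.
have B0 x : 0 <= B x by rewrite BE; case: ifP => // _; exact: expR_ge0.
have sB : smooth B := flat_fun_smooth 1 0.
have cB := smooth_continuous _ sB.
have Bout x : ~ (`[0, 1]%classic x) -> B x = 0.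
  rewrite BE /= in_itv/= => x01; case: ifPn => // /andP[x0 x1].
  by exfalso; apply: x01; rewrite !ltW.
have iB : mu.-integrable setT (EFin \o B).
  have : mu.-integrable `[0, 1] (EFin \o B).
    apply: continuous_compact_integrable; first exact: segment_compact.
    exact: continuous_subspaceT.
  rewrite integrable_mkcond// restrict_EFin.
  by congr (mu.-integrable _ (EFin \o _)); apply/funext => x; rewrite patchE;
    case: ifPn => // /negP xn; rewrite Bout// => x01; apply: xn; rewrite inE.
have iB' A : measurable A -> mu.-integrable A (EFin \o B).
  by move=> mA; exact: integrableS iB.
pose F x := \int[mu]_(s in `]-oo, x]) B s.
have dF x : is_derive x 1 F (B x).
  have xx1 : x < x + 1 by rewrite ltrDl.
  have ix : mu.-integrable `]-oo, x + 1] (EFin \o B) by exact: iB'.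
  have [] := continuous_FTC1 xx1 ix (ltNyr x) (cB x).
  move=> dFx F'x.
  by split; [exact: dFx|rewrite -derive1E; exact: F'x].
have F0 x : x <= 0 -> F x = 0.
  move=> x0; rewrite /F (@eq_Rintegral _ _ _ _ _ (cst 0)).
    by rewrite /Rintegral integral0.
  move=> s; rewrite inE/= in_itv/= => sx; rewrite BE ltNge.
  by rewrite (le_trans sx x0).
(* The bump vanishes outside [ ]0, 1[ ], so [F] is constant on both sides. *)
have F1 x : 1 <= x -> F x = \int[mu]_s B s.
  move=> x1; rewrite /F Rintegral_mkcond; congr Rintegral; apply/funext => s.
  rewrite patchE; case: ifPn => // /negP xn; rewrite Bout//= in_itv/= => s01.
  apply: xn; rewrite inE/= in_itv/=; case/andP: s01 => _ s1.
  exact: le_trans x1.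
have Fnd x y : x <= y -> F x <= F y.
  move=> xy; rewrite /F [leLHS]Rintegral_mkcond [leRHS]Rintegral_mkcond.
  apply: le_Rintegral => //.
  - by rewrite -restrict_EFin -integrable_mkcond//; exact: iB'.
  - by rewrite -restrict_EFin -integrable_mkcond//; exact: iB'.
  move=> s _; rewrite !patchE; case: ifPn => [|_]; last by case: ifPn.
  by rewrite inE/= in_itv/= => sx; rewrite ifT// inE/= in_itv/= (le_trans sx).
have I0 : 0 < \int[mu]_s B s.
  have F1_ge0 : 0 <= F 1 by rewrite -(F0 _ (lexx 0)); exact: Fnd.
  rewrite -(F1 _ (lexx 1)) lt_neqAle F1_ge0 andbT.
  apply/eqP => F10; have h : 0 < (2^-1 : R) < 1 by apply/andP; split; lra.
  have := dF 2^-1; rewrite BE h => d.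
  have : is_derive (2^-1 : R) 1 F 0.
    apply: (@near_eq_is_derive _ _ _ (cst (0 : R))).
    have : (2^-1 : R) \in `]0, 1[ by rewrite in_itv.
    move=> /near_in_itvoo; apply: filterS => y; rewrite in_itv/= => /andP[y0 y1].
    have := Fnd _ _ (ltW y0); have := Fnd _ _ (ltW y1).
    by rewrite (F0 _ (lexx 0)) -F10 => Fy0 Fy0'; apply/eqP; rewrite eq_le Fy0 Fy0'.
  move=> d0; have := @derive_val _ _ _ _ _ _ _ d.
  rewrite (@derive_val _ _ _ _ _ _ _ d0) => /esym/eqP.
  by rewrite gt_eqF ?expR_gt0.
set I := \int[mu]_s B s in I0 F1.
exists (fun x => F x * I^-1); split.
- have sF : smooth F := smooth_antiderivative _ _ dF sB.
  apply: (@smooth_coind (fun f => exists2 g, smooth g & f = fun x => g x * I^-1)).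
    move=> _ [g sg ->]; have dg x : derivable g x 1 := sg 0%N x.
    split=> [x|]; first by apply: (@derivableM _ _ g (cst I^-1)) => //; exact: derivable_cst.
    exists (derive1 g); first exact: smooth_derive1.
    by apply/funext => x; rewrite derive1Mr.
  by exists F.
- by move=> x /F0 ->; rewrite mul0r.
- by move=> x /F1 ->; rewrite divff ?gt_eqF.
- move=> x; apply/andP; split.
    rewrite divr_ge0 ?(ltW I0)//; have [x0|x0] := leP x 0; first by rewrite F0.
    by rewrite -(F0 _ (lexx 0)) Fnd// ltW.
  rewrite ler_pdivrMr// mul1r; have [x1|x1] := leP 1 x; first by rewrite F1.
  by rewrite -(F1 _ (lexx 1)) Fnd// ltW.
exists I^-1 => x; have dFx : derivable F x 1 by have [] := dF x.
rewrite derive1Mr// derive1E derive_val ger0_norm ?divr_ge0 ?(ltW I0)//.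
rewrite ler_piMl ?invr_ge0 ?(ltW I0)// BE; case: ifPn => // /andP[x0 x1].
by rewrite expRN invf_le1 ?expR_gt0// ltW// expR_gt1 invr_gt0 mulr_gt0 ?subr_gt0.
Qed.

End SmoothFunctions.

(** * Integrals of functions on the line *)

Section IntegralHelpers.
Context {R : realType}.
Implicit Types (f g c : R -> R) (D : set R).
Local Notation mu := (@lebesgue_measure R).

Lemma integrable_mul_bounded D f c M : measurable D ->
  mu.-integrable D (EFin \o f) -> measurable_fun D c ->
  (forall x, D x -> `|c x| <= M) ->
  mu.-integrable D (fun x => (f x * c x)%:E).
Proof.
move=> mD fi mc cM.
have bc : [bounded c x | x in D].
  exists M; split; first exact: num_real.
  by move=> N MN x Dx; apply: le_trans (cM _ Dx) (ltW MN).
exact: (@integrableMl _ _ _ mu D mD _ _ fi mc bc).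
Qed.

Lemma is_derive_continuous f g (x : R) : is_derive x 1 f (g x) -> {for x, continuous f}.
Proof. by case=> /derivable1_diffP/differentiable_continuous. Qed.

Lemma FTC2_is_derive (F f : R -> R) (a b : R) : a <= b ->
  (forall x, a <= x <= b -> is_derive x 1 F (f x)) ->
  {within `[a, b], continuous f} ->
  (\int[mu]_(x in `[a, b]) (f x)%:E)%E = (F b - F a)%:E.
Proof.
rewrite le_eqVlt => /predU1P[<- _ _|ab dF cf].
  by rewrite set_itv1 integral_set1 subrr.
rewrite (continuous_FTC2 ab cf (F := F)) ?EFinB//.
- split.
  + by move=> x; rewrite in_itv/= => /andP[ax xb]; have [] := dF x _; rewrite ?ltW.
  + apply: cvg_at_right_filter; apply: (@is_derive_continuous F f).
    by apply: dF; rewrite lexx ltW.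
  + apply: cvg_at_left_filter; apply: (@is_derive_continuous F f).
    by apply: dF; rewrite lexx ltW.
- move=> x; rewrite in_itv/= => /andP[ax xb].
  have xab : a <= x <= b by rewrite !ltW.
  by have d := dF _ xab; rewrite derive1E derive_val.
Qed.

(** Passes from an integral over a set to one over the whole line. *)
Lemma restrict_id_out f (A : set R) : (forall x, ~ A x -> f x = 0) -> f \_ A = f.
Proof.
move=> fA; apply/funext => x; rewrite patchE; case: ifPn => // /negP xA.
by rewrite fA// => Ax; apply: xA; rewrite inE.
Qed.

Lemma continuous_out_integrable f (a b : R) : continuous f ->
  (forall x, ~ (a <= x <= b) -> f x = 0) -> mu.-integrable setT (EFin \o f).
Proof.
move=> cf fab; rewrite -(@restrict_id_out f `[a, b]); last first.
  by move=> x /= xab; apply: fab => axb; apply: xab; rewrite in_itv.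
rewrite -restrict_EFin -integrable_mkcond//.
apply: continuous_compact_integrable; first exact: segment_compact.
exact: continuous_subspaceT.
Qed.

End IntegralHelpers.

(** * The fundamental theorem for weak derivatives *)

Section duBoisReymond.
Context {R : realType}.
Local Notation mu := (@lebesgue_measure R).
Variables (S : R -> R) (M : R).
Hypotheses (sS : smooth S) (S0 : forall x, x <= 0 -> S x = 0)
  (S1 : forall x, 1 <= x -> S x = 1) (S01 : forall x, 0 <= S x <= 1)
  (S'M : forall x, `|derive1 S x| <= M).

(** A mollifier of mass one supported in [[a, a + e]], equal to the derivative
    of the smooth step from [0] at [a] to [1] at [a + e]. *)
Let D (a e x : R) : R := e^-1 * derive1 S ((x - a) / e).

Lemma is_derive_step (a e x : R) :
  is_derive x 1 (fun y => S ((y - a) / e)) (D a e x).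
Proof.
have d : derivable S ((x - a) / e) 1 := sS 0%N _.
have dS : is_derive ((x - a) / e) 1 S (derive1 S ((x - a) / e)).
  by rewrite derive1E; exact: derivableP.
have dl : is_derive x 1 (fun y => (y - a) / e) e^-1.
  apply: is_derive_eq.
  by rewrite /GRing.scale/= mulr0 add0r subr0 mulr1.
rewrite /D mulrC.
exact: (@is_derive1_comp _ S (fun y => (y - a) / e)).
Qed.

Let cD (a e : R) : continuous (D a e).
Proof.
move=> x; apply: cvgM; first exact: cvg_cst.
apply: (@continuous_comp _ _ _ (fun y => (y - a) / e) (derive1 S)).
  by apply: cvgM; [apply: cvgB; [exact: cvg_id|exact: cvg_cst]|exact: cvg_cst].
exact: smooth_continuous (smooth_derive1 _ sS) _.
Qed.

Let derive1S_out (x : R) : ~ (0 <= x <= 1) -> derive1 S x = 0.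
Proof.
move=> x01; rewrite derive1E; have [x0|x0] := ltP x 0.
  rewrite (@near_eq_derive _ _ _ _ (cst (0 : R))) ?derive_cst//.
  have : x \in `]-oo, 0[ by rewrite in_itv.
  by move=> /near_in_itvNyo; apply: filterS => y; rewrite in_itv/= => /ltW/S0.
have x1 : 1 < x by rewrite ltNge; apply/negP => x1; apply: x01; rewrite x0.
rewrite (@near_eq_derive _ _ _ _ (cst (1 : R))) ?derive_cst//.
have : x \in `]1, +oo[ by rewrite in_itv/= x1.
by move=> /near_in_itvoy; apply: filterS => y; rewrite in_itv/= andbT => /ltW/S1.
Qed.

Let D_out (a e x : R) : 0 < e -> ~ (a <= x <= a + e) -> D a e x = 0.
Proof.
move=> e0 xa; rewrite /D derive1S_out ?mulr0// => xae; apply: xa; move: xae.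
by rewrite pmulr_lge0 ?invr_gt0// subr_ge0 ler_pdivrMr// mul1r lerBlDl.
Qed.


Let D_le a e x : 0 < e -> `|D a e x| <= M / e.
Proof.
move=> e0; rewrite /D normrM ger0_norm ?invr_ge0 ?(ltW e0)// mulrC.
by rewrite ler_wpM2r ?invr_ge0 ?(ltW e0).
Qed.

Let M0 : 0 <= M. Proof. exact: le_trans (normr_ge0 _) (S'M 0). Qed.

Let iD a e : 0 < e -> mu.-integrable setT (EFin \o D a e).
Proof.
move=> e0; apply: (@continuous_out_integrable _ _ a (a + e)); first exact: cD.
by move=> x; exact: D_out.
Qed.

Let intD a e : 0 < e -> \int[mu]_x D a e x = 1.
Proof.
move=> e0; rewrite -(@restrict_id_out _ (D a e) `[a, a + e]); last first.
  by move=> x /= xab; apply: D_out => // axb; apply: xab; rewrite in_itv.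
rewrite -Rintegral_mkcond /Rintegral.
have dS y : a <= y <= a + e ->
    is_derive y 1 (fun y => S ((y - a) / e)) (D a e y).
  by move=> _; exact: is_derive_step.
have ae : a <= a + e by rewrite lerDl ltW.
have cDe : {within `[a, a + e], continuous D a e}.
  exact/continuous_subspaceT/cD.
have -> := FTC2_is_derive _ _ _ _ ae dS cDe.
by rewrite /= addrAC !subrr add0r mul0r divff ?gt_eqF// (S0 _ (lexx 0)) (S1 _ (lexx 1)) subr0.
Qed.

(** The mollifier has mass one and is at most [M / e], so the error is an
    average of [|w - w a|] near [a].  The ball has radius [2 e] because it is
    open and has to contain the endpoint [a + e]. *)
Lemma step_average (w : R -> R) a e : 0 < e -> mu.-integrable setT (EFin \o w) ->
  (`| \int[mu]_x (w x * D a e x) - w a |%:E <= (M * 4)%:E * davg w a (2 * e))%E.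
Proof.
move=> e0 iw.
have mD : measurable_fun setT (D a e) by apply: continuous_measurable_fun; exact: cD.
have mw : measurable_fun setT w by have /integrableP[/measurable_EFinP] := iw.
have iwD : mu.-integrable setT (fun x => (w x * D a e x)%:E).
  by apply: (@integrable_mul_bounded _ _ _ _ (M / e)) => // x _; exact: D_le.
have iaD : mu.-integrable setT (fun x => (w a * D a e x)%:E).
  exact: (@integrableZl _ _ _ mu _ measurableT (w a) _ (iD a e e0)).
have -> : \int[mu]_x (w x * D a e x) - w a =
          \int[mu]_x ((w x - w a) * D a e x).
  rewrite -{1}(mulr1 (w a)) -(@intD a e)// -RintegralZl//; last exact: iD.
  by rewrite -RintegralB//; apply: eq_Rintegral => x _; rewrite mulrBl.
have ei : mu.-integrable setT (fun x => ((w x - w a) * D a e x)%:E).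
  under eq_fun do rewrite mulrBl EFinB.
  exact: (@integrableB _ _ _ mu).
have mwa : measurable_fun setT (fun x => w x - w a) by exact: measurable_funB.
have mwaD : measurable_fun setT (fun x => (w x - w a) * D a e x).
  exact: measurable_funM.
rewrite EFin_normr_Rintegral//.
apply: (le_trans (le_abse_integral _ measurableT (measurable_int _ ei))).
have mb : measurable (ball a (2 * e)) by exact: measurable_ball.
have -> : (\int[mu]_x `|((w x - w a) * D a e x)%:E| =
   \int[mu]_(x in ball a (2 * e)) `|((w x - w a) * D a e x)%:E|)%E.
  rewrite [RHS]integral_mkcond; apply: eq_integral => x _; rewrite patchE.
  case: ifPn => // xb; rewrite D_out ?mulr0 ?abse0// => /andP[ax xe].
  move/negP: xb; apply; rewrite inE /ball/= ltr_norml; apply/andP; split; lra.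
apply: (@le_trans _ _ (\int[mu]_(x in ball a (2 * e))
   ((M / e)%:E * `|(w x - w a)%:E|))%E).
  apply: ge0_le_integral => //.
  - by apply/measurableT_comp => //; apply/measurable_EFinP/measurable_funTS.
  - apply: emeasurable_funM => //; apply: measurableT_comp => //.
    exact/measurable_EFinP/measurable_funTS.
  - by move=> x _; rewrite -EFinM lee_fin normrM mulrC ler_wpM2r// D_le.
rewrite ge0_integralZl//; last 2 first.
  by apply: measurableT_comp => //; apply/measurable_EFinP/measurable_funTS.
  by rewrite lee_fin divr_ge0// ltW.
rewrite /davg /iavg lebesgue_measure_ball ?mulr_ge0 ?(ltW e0)//.
rewrite inver ifF; last by rewrite mulrn_eq0/= gt_eqF// mulr_gt0.
rewrite muleA -EFinM; apply: lee_pmul => //.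
- by rewrite lee_fin divr_ge0// ltW.
- exact: integral_ge0.
- rewrite lee_fin le_eqVlt; apply/orP; left; apply/eqP.
  by field; rewrite gt_eqF.
Qed.


Lemma step_average_cvg (w : R -> R) a (e_ : nat -> R) : (forall n, 0 < e_ n) ->
  e_ n @[n --> \oo] --> 0 -> mu.-integrable setT (EFin \o w) ->
  lebesgue_pt w a -> \int[mu]_x (w x * D a (e_ n) x) @[n --> \oo] --> w a.
Proof.
move=> e0 ecvg iw wa; apply/subr_cvg0/norm_cvg0P.
have d0 : davg w a (2 * e_ n) @[n --> \oo] --> 0%E.
  move/cvge_at_rightP : wa => /(_ (fun n => 2 * e_ n)); apply; split.
    by move=> n; rewrite mulr_gt0.
  by rewrite -(mulr0 2); apply: cvgMr.
apply: (@fine_cvg _ _ _ _ (fun n => `|\int[mu]_x (w x * D a (e_ n) x) - w a|%:E)).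
apply: (@squeeze_cvge _ _ _ _ (cst 0%E) _
  (fun n => (M * 4)%:E * davg w a (2 * e_ n))%E).
- apply: nearW => n; rewrite lee_fin normr_ge0/=.
  exact: step_average.
- exact: cvg_cst.
- have -> : 0%:E = ((M * 4)%:E * 0)%E by rewrite mule0.
  by apply: cvgeM => //; exact: cvg_cst.
Qed.

(** A smooth approximation of the indicator of [ ]a, b] ]. *)
Let phi a b e x : R := S ((x - a) / e) - S ((x - b) / e).

Lemma smooth_phi a b e : smooth (phi a b e).
Proof.
pose C := [set f : R -> R | exists c g, smooth g /\
  f = fun x => c * (g ((x - a) / e) - g ((x - b) / e))].
apply: (@smooth_coind _ C); last first.
  by exists 1, S; split => //; apply/funext => x; rewrite mul1r.
move=> _ [c [g [sg ->]]].
have d1 (y x : R) : is_derive x 1 (fun z => g ((z - y) / e)) (derive1 g ((x - y) / e) * e^-1).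
  have dg : is_derive ((x - y) / e) 1 g (derive1 g ((x - y) / e)).
    by rewrite derive1E; apply: derivableP; exact: (sg 0%N).
  have dl : is_derive x 1 (fun z => (z - y) / e) e^-1.
    by apply: is_derive_eq; rewrite /GRing.scale/= mulr0 add0r subr0 mulr1.
  exact: (@is_derive1_comp _ g (fun z => (z - y) / e)).
have d2 (x : R) : is_derive x 1 (fun z => c * (g ((z - a) / e) - g ((z - b) / e)))
    (c * e^-1 * (derive1 g ((x - a) / e) - derive1 g ((x - b) / e))).
  rewrite -mulrA mulrBr ![e^-1 * _]mulrC.
  exact: (is_deriveZ c (is_deriveB (d1 a x) (d1 b x))).
split; first by move=> x; have [] := d2 x.
exists (c * e^-1), (derive1 g); split; first exact: smooth_derive1.
by apply/funext => x; rewrite derive1E; exact: derive_val.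
Qed.

Lemma phi_derive1 a b e x : derive1 (phi a b e) x = D a e x - D b e x.
Proof.
rewrite derive1E; apply: derive_val.
exact: is_deriveB (is_derive_step a e x) (is_derive_step b e x).
Qed.

Lemma phi_out a b e x : 0 < e -> a < b -> ~ (a <= x <= b + e) -> phi a b e x = 0.
Proof.
move=> e0 ab xab; rewrite /phi; have [xa|ax] := ltP x a.
  rewrite !S0 ?subrr//; rewrite pmulr_lle0 ?invr_gt0// subr_le0 ltW//.
  exact: lt_trans ab.
have bx : b + e < x by rewrite ltNge; apply/negP => bx; apply: xab; rewrite ax.
rewrite !S1 ?subrr// ler_pdivlMr// mul1r lerBrDl ltW//.
by apply: lt_trans bx; rewrite ltrD2r.
Qed.

Lemma phi_test a b e (A B : R) : 0 < e -> a < b -> A < a -> b + e < B ->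
  test_function `]A, B[ (phi a b e).
Proof.
move=> e0 ab Aa bB.
have cl : closure [set x | phi a b e x != 0] `<=` `[a, b + e].
  rewrite closureE; apply: smallest_sub; first exact: itv_closed.
  move=> x /= /eqP px; rewrite in_itv/=; apply: contrapT => xab; apply: px.
  exact: phi_out.
split; first exact: smooth_phi.
- apply: (@subclosed_compact _ _ `[a, b + e]) => //; first exact: closed_closure.
  exact: segment_compact.
- apply: (subset_trans cl) => x /=; rewrite !in_itv/= => /andP[ax xb].
  by rewrite (lt_le_trans Aa)// (le_lt_trans xb).
Qed.

Lemma phi_le1 a b e x : `|phi a b e x| <= 1.
Proof.
have := S01 ((x - a) / e); have := S01 ((x - b) / e).
by rewrite /phi ler_norml => /andP[? ?] /andP[? ?]; apply/andP; split; lra.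
Qed.

Lemma phi_cvg a b (e_ : nat -> R) x : a < b -> (forall n, 0 < e_ n) ->
  e_ n @[n --> \oo] --> 0 -> phi a b (e_ n) x @[n --> \oo] --> (\1_(`]a, b]) x : R).
Proof.
move=> ab e0 ecvg; rewrite indicE; apply: cvg_near_cst.
have [xa|ax] := leP x a.
  apply: nearW => n; rewrite memNset/= ?in_itv/= ?ltNge ?xa//.
  by rewrite /phi !S0 ?subrr// pmulr_lle0 ?invr_gt0// subr_le0 // (le_trans xa)// ltW.
have [xb|bx] := leP x b.
  have : \forall n \near \oo, e_ n < x - a by apply: (cvgr_lt 0) => //; rewrite subr_gt0.
  apply: filterS => n en; rewrite mem_set/= ?in_itv/= ?ax ?xb// /phi S1 ?S0 ?subr0//.
    by rewrite pmulr_lle0 ?invr_gt0// subr_le0.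
  by rewrite ler_pdivlMr// mul1r ltW.
have : \forall n \near \oo, e_ n < x - b by apply: (cvgr_lt 0) => //; rewrite subr_gt0.
apply: filterS => n en; rewrite memNset/= ?in_itv/= ?ax/=; last first.
  by rewrite leNgt bx.
by rewrite /phi !S1 ?subrr// ler_pdivlMr// mul1r ltW// (lt_trans en)// ltrD2l ltrN2.
Qed.


(** Testing against the smoothed indicator: its derivative is the difference of
    the mollifiers at [a] and [b], which recover [w a] and [w b] in the limit at
    Lebesgue points, while dominated convergence gives the integral of [k]. *)
Lemma weak_derivative_FTC_step (A B a b : R) (w k : R -> R) :
  mu.-integrable setT (EFin \o w) -> mu.-integrable setT (EFin \o k) ->
  (forall phi, test_function `]A, B[ phi ->
     \int[mu]_x (w x * derive1 phi x) = - \int[mu]_x (k x * phi x)) ->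
  A < a -> a < b -> b < B -> lebesgue_pt w a -> lebesgue_pt w b ->
  w b - w a = \int[mu]_(x in `]a, b]) k x.
Proof.
move=> iw ik wk Aa ab bB wa wb.
(* The support [[a, b + e]] has to stay inside [ ]A, B[ ]. *)
pose e_ n : R := (B - b) / 2 * n.+1%:R^-1.
have e0 n : 0 < e_ n by rewrite mulr_gt0 ?divr_gt0 ?subr_gt0.
have ecvg : e_ n @[n --> \oo] --> 0.
  rewrite -[X in _ --> X](mulr0 ((B - b) / 2)).
  by apply: cvgMr; exact: cvg_harmonic.
have eB n : b + e_ n < B.
  have : e_ n <= (B - b) / 2.
    by rewrite ler_piMr ?divr_ge0 ?subr_ge0 ?(ltW bB)// invf_le1 ?ler1n// ltr0n.
  lra.
have mk : measurable_fun setT k by have /integrableP[/measurable_EFinP] := ik.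
have mphi n : measurable_fun setT (phi a b (e_ n)).
  by apply: continuous_measurable_fun; apply: smooth_continuous; exact: smooth_phi.
have c1 : \int[mu]_x (w x * derive1 (phi a b (e_ n)) x) @[n --> \oo] --> w a - w b.
  have iwD c n : mu.-integrable setT (fun x => (w x * D c (e_ n) x)%:E).
    apply: (@integrable_mul_bounded _ _ _ _ (M / e_ n)) => //.
      by apply: continuous_measurable_fun; exact: cD.
    by move=> x _; exact: D_le.
  have -> : (fun n => \int[mu]_x (w x * derive1 (phi a b (e_ n)) x)) =
    (fun n => \int[mu]_x (w x * D a (e_ n) x) - \int[mu]_x (w x * D b (e_ n) x)).
    apply/funext => n.
    rewrite -(@RintegralB _ _ _ mu _ _ _ measurableT (iwD a n) (iwD b n)).
    apply: (@eq_Rintegral _ _ _ mu) => x _.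
    by rewrite phi_derive1 mulrBr.
  by apply: cvgB; exact: step_average_cvg.
have c2 : \int[mu]_x (k x * phi a b (e_ n) x) @[n --> \oo] -->
          \int[mu]_(x in `]a, b]) k x.
  apply: (@fine_cvg _ _ _ _ (fun n => \int[mu]_x (k x * phi a b (e_ n) x)%:E)%E).
  rewrite fineK; last first.
    by apply: (@integrable_fin_num _ _ _ mu) => //; exact: integrableS ik.
  rewrite integral_mkcond.
  have mkphi n : measurable_fun setT (fun x => k x * phi a b (e_ n) x).
    exact: measurable_funM.
  have mki : measurable_fun setT (fun x => k x * \1_(`]a, b]) x).
    by apply: measurable_funM => //; exact: measurable_indic.
  have kcvg : {ae mu, forall x, setT x ->
      (fun n => (k x * phi a b (e_ n) x)%:E) @ \oo --> (k x * \1_(`]a, b]) x)%:E}.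
    apply: aeW => x _; apply: cvg_EFin; first exact: nearW.
    by apply: cvgM; [exact: cvg_cst|exact: phi_cvg].
  have kdom : {ae mu, forall x n, setT x ->
      (`|(k x * phi a b (e_ n) x)%:E| <= `|(k x)%:E|)%E}.
    apply: aeW => x n _; rewrite lee_fin normrM.
    by rewrite ler_piMr ?normr_ge0// phi_le1.
  have [_ _] := @dominated_convergence _ _ _ mu setT measurableT _ _ _
    (fun n => proj2 (measurable_EFinP _ _) (mkphi n))
    (proj2 (measurable_EFinP _ _) mki) kcvg
    (@integrable_abse _ _ _ mu _ _ ik) kdom.
  move=> kc; suff -> : (\int[mu]_x ((EFin \o k) \_ `]a, b]) x =
    \int[mu]_x (k x * \1_(`]a, b]) x)%:E)%E by exact: kc.
  apply: eq_integral => x _.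
  by rewrite patchE indicE; case: ifPn => xab; rewrite ?mulr1 ?mulr0.
have c3 : \int[mu]_x (w x * derive1 (phi a b (e_ n)) x) @[n --> \oo] -->
          - \int[mu]_(x in `]a, b]) k x.
  suff -> : (fun n => \int[mu]_x (w x * derive1 (phi a b (e_ n)) x)) =
      (fun n => - \int[mu]_x (k x * phi a b (e_ n) x)) by exact: cvgN.
  by apply/funext => n; apply: wk; exact: phi_test.
have c13 := @cvg_unique _ (@Rhausdorff R) _ _ _ _ c1 c3.
by rewrite -[RHS]opprK -c13 opprB.
Qed.

End duBoisReymond.

Lemma weak_derivative_FTC {R : realType} (A B a b : R) (w k : R -> R) :
  (@lebesgue_measure R).-integrable setT (EFin \o w) ->
  (@lebesgue_measure R).-integrable setT (EFin \o k) ->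
  (forall phi, test_function `]A, B[ phi ->
     \int[@lebesgue_measure R]_x (w x * derive1 phi x) =
     - \int[@lebesgue_measure R]_x (k x * phi x)) ->
  A < a -> a < b -> b < B -> lebesgue_pt w a -> lebesgue_pt w b ->
  w b - w a = \int[@lebesgue_measure R]_(x in `]a, b]) k x.
Proof.
have [S [sS S0 S1 S01 [M S'M]]] := @smooth_step R.
exact: weak_derivative_FTC_step sS S0 S1 S01 S'M A B a b w k.
Qed.

(** * Exchange of integrals over a triangle, and the product rule *)

Section Triangle.
Context {R : realType}.
Local Notation mu := (@lebesgue_measure R).
Local Open Scope ereal_scope.

(** The product of [f1] and [f2] cut off to the triangle where the second
    variable is at most the first. *)
Let F (f1 f2 : R -> R) (z : R * R) : \bar R :=
  (f1 z.1 * f2 z.2 * (z.2 <= z.1)%R%:R)%:E.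

Let mF (f1 f2 : R -> R) : measurable_fun setT f1 -> measurable_fun setT f2 ->
  measurable_fun setT (F f1 f2).
Proof.
move=> m1 m2; apply/measurable_EFinP; apply: measurable_funM.
  by apply: measurable_funM; exact: measurableT_comp.
have mT : measurable [set z : R * R | (z.2 <= z.1)%R].
  by rewrite -[X in measurable X]setTI; apply: measurable_fun_le => //.
rewrite (_ : (fun _ => _) = \1_[set z : R * R | (z.2 <= z.1)%R]).
  exact: measurable_indic.
apply/funext => z; rewrite indicE; congr (_%:R); apply/esym.
by case: (boolP (z.2 <= z.1)%R) => h; [rewrite mem_set|rewrite memNset//=; apply/negP].
Qed.

Let Fsection1 (f1 f2 : R -> R) x : (fun y => F f1 f2 (x, y)) =
  (fun y => (f1 x)%:E * ((EFin \o f2) \_ `]-oo, x]) y).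
Proof.
apply/funext => y; rewrite /F/= patchE mem_setE in_itv/=.
by case: ifP; rewrite ?mulr1 ?mulr0 ?mule0 ?EFinM.
Qed.

Let Fsection2 (f1 f2 : R -> R) y : (fun x => F f1 f2 (x, y)) =
  (fun x => (f2 y)%:E * ((EFin \o f1) \_ `[y, +oo[) x).
Proof.
apply/funext => x; rewrite /F/= patchE mem_setE in_itv/= andbT.
by case: ifP; rewrite ?mulr1 ?mulr0 ?mule0 -?EFinM 1?mulrC.
Qed.

Lemma tonelli_triangle (f1 f2 : R -> R) :
  measurable_fun setT f1 -> measurable_fun setT f2 ->
  (forall x, 0 <= f1 x)%R -> (forall x, 0 <= f2 x)%R ->
  \int[mu]_x ((f1 x)%:E * \int[mu]_(y in `]-oo, x]) (f2 y)%:E) =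
  \int[mu]_y ((f2 y)%:E * \int[mu]_(x in `[y, +oo[) (f1 x)%:E).
Proof.
move=> m1 m2 p1 p2.
have F0 z : 0 <= F f1 f2 z by rewrite lee_fin !mulr_ge0.
have := @fubini_tonelli _ _ _ _ R mu mu _ (mF _ _ m1 m2) F0.
have e1 x : \int[mu]_y F f1 f2 (x, y) =
    (f1 x)%:E * \int[mu]_(y in `]-oo, x]) (f2 y)%:E.
  rewrite Fsection1 [in RHS]integral_mkcond ge0_integralZl//.
  - apply/(measurable_restrictT _ _).1 => //.
    exact/measurable_EFinP/measurable_funTS.
  - by move=> z _; rewrite patchE; case: ifP; rewrite ?lee_fin.
  - by rewrite lee_fin.
have e2 y : \int[mu]_x F f1 f2 (x, y) =
    (f2 y)%:E * \int[mu]_(x in `[y, +oo[) (f1 x)%:E.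
  rewrite Fsection2 [in RHS]integral_mkcond ge0_integralZl//.
  - apply/(measurable_restrictT _ _).1 => //.
    exact/measurable_EFinP/measurable_funTS.
  - by move=> z _; rewrite patchE; case: ifP; rewrite ?lee_fin.
  - by rewrite lee_fin.
move=> FE; transitivity (\int[mu]_x \int[mu]_y F f1 f2 (x, y)).
  by apply: eq_integral => x _; rewrite e1.
by rewrite FE; apply: eq_integral => y _; rewrite e2.
Qed.

Lemma measurable_primitive (f : R -> R) :
  measurable_fun setT f -> (forall x : R, 0 <= f x)%R ->
  measurable_fun setT (fun x : R => \int[mu]_(y in `]-oo, x]) (f y)%:E).
Proof.
move=> mf f0.
have mF1 := mF _ _ (@measurable_cst _ _ _ _ setT (1%R : R)) mf.
have F0 z : 0 <= F (cst 1%R) f z by rewrite lee_fin !mulr_ge0.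
have := @measurable_fun_fubini_tonelli_F _ _ _ _ R mu _ mF1 F0.
congr measurable_fun; apply/funext => x.
rewrite /fubini_F Fsection1 [in RHS]integral_mkcond.
by apply: eq_integral => y _; rewrite mul1e.
Qed.

Lemma measurable_coprimitive (f : R -> R) :
  measurable_fun setT f -> (forall x : R, 0 <= f x)%R ->
  measurable_fun setT (fun y : R => \int[mu]_(x in `[y, +oo[) (f x)%:E).
Proof.
move=> mf f0.
have mF1 := mF _ _ mf (@measurable_cst _ _ _ _ setT (1%R : R)).
have F0 z : 0 <= F f (cst 1%R) z by rewrite lee_fin !mulr_ge0.
have := @measurable_fun_fubini_tonelli_G _ _ _ _ R mu _ mF1 F0.
congr measurable_fun; apply/funext => x.
rewrite /fubini_G Fsection2 [in RHS]integral_mkcond.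
by apply: eq_integral => y _; rewrite mul1e.
Qed.

Lemma fubini_triangle (f1 f2 : R -> R) :
  mu.-integrable setT (EFin \o f1) -> mu.-integrable setT (EFin \o f2) ->
  mu.-integrable setT
    (fun x => (f1 x)%:E * \int[mu]_(y in `]-oo, x]) (f2 y)%:E) /\
  \int[mu]_x ((f1 x)%:E * \int[mu]_(y in `]-oo, x]) (f2 y)%:E) =
  \int[mu]_y ((f2 y)%:E * \int[mu]_(x in `[y, +oo[) (f1 x)%:E).
Proof.
move=> i1 i2.
have m1 : measurable_fun setT f1 by have /integrableP[/measurable_EFinP] := i1.
have m2 : measurable_fun setT f2 by have /integrableP[/measurable_EFinP] := i2.
have iF : (mu \x mu).-integrable setT (F f1 f2).
  apply/(@integrable12ltyP _ _ _ _ R mu mu _ (mF _ _ m1 m2)).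
  have h x : \int[mu]_y `|F f1 f2 (x, y)| <= `|(f1 x)%:E| * \int[mu]_y `|(f2 y)%:E|.
    rewrite -ge0_integralZl//; last first.
      by apply: measurableT_comp => //; exact/measurable_EFinP.
    apply: ge0_le_integral => //.
    - apply: measurableT_comp => //.
      exact: measurableT_comp (mF _ _ m1 m2) (pair1_measurable x).
    - apply: emeasurable_funM => //; apply: measurableT_comp => //.
      exact/measurable_EFinP.
    move=> y _; rewrite /F/= lee_fin !normrM.
    by case: (y <= x)%R; rewrite ?normr1 ?mulr1// normr0 mulr0 mulr_ge0.
  apply: (@le_lt_trans _ _ (\int[mu]_x (`|(f1 x)%:E| * \int[mu]_y `|(f2 y)%:E|))).
    apply: ge0_le_integral => //.
    - by move=> x _; exact: integral_ge0.
    - apply: (@measurable_fun_fubini_tonelli_F _ _ _ _ R mu (abse \o F f1 f2)) => //.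
      by apply: measurableT_comp => //; exact: mF.
      by move=> z; exact: abse_ge0.
    - apply: emeasurable_funM => //; apply: measurableT_comp => //.
      exact/measurable_EFinP.
  rewrite ge0_integralZr//.
  - have /integrableP[_ l1] := i1; have /integrableP[_ l2] := i2.
    apply: lte_mul_pinfty => //; first exact: integral_ge0.
    by rewrite ge0_fin_numE//; exact: integral_ge0.
  - by apply: measurableT_comp => //; exact/measurable_EFinP.
  - exact: integral_ge0.
have e1 x : \int[mu]_y F f1 f2 (x, y) =
    (f1 x)%:E * \int[mu]_(y in `]-oo, x]) (f2 y)%:E.
  rewrite Fsection1 [in RHS]integral_mkcond integralZl//.
  by rewrite -integrable_mkcond//; exact: integrableS i2.
have e2 y : \int[mu]_x F f1 f2 (x, y) =
    (f2 y)%:E * \int[mu]_(x in `[y, +oo[) (f1 x)%:E.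
  rewrite Fsection2 [in RHS]integral_mkcond integralZl//.
  by rewrite -integrable_mkcond//; exact: integrableS i1.
split.
  apply: (@eq_integrable _ _ _ mu _ measurableT _ _ _
    (@integrable_fubini_F _ _ _ _ R mu mu _ iF)).
  by move=> x _; rewrite -e1.
transitivity (\int[mu]_x \int[mu]_y F f1 f2 (x, y)).
  by apply: eq_integral => x _; rewrite e1.
rewrite (@Fubini _ _ _ _ R mu mu _ iF).
by apply: eq_integral => y _; rewrite e2.
Qed.

End Triangle.

Section ProductRule.
Context {R : realType}.
Local Notation mu := (@lebesgue_measure R).

Lemma within_continuous_bounded (f : R -> R) (a b : R) :
  {within `[a, b], continuous f} ->
  exists M, forall x, a <= x <= b -> `|f x| <= M.
Proof.
move=> cf.
have /compact_bounded[M [_ fM]] := continuous_compact cf (@segment_compact _ a b).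
exists (M + 1) => x xab; apply: fM; first by rewrite ltrDl.
by exists x => //=; rewrite in_itv.
Qed.

(** The function [w] is a.e. a primitive of [k] and [m] is C^1.  Writing [w] as
    an integral in the term with [m' w], and exchanging the order of integration over
    the triangle, replaces [m'] by [m b - m y]. *)
Lemma FTC_product_rule (w k m m' : R -> R) (a b : R) : a < b ->
  mu.-integrable `]a, b] (EFin \o k) ->
  measurable_fun `]a, b] w ->
  (forall x, a <= x <= b -> is_derive x 1 m (m' x)) ->
  {within `[a, b], continuous m'} ->
  {ae mu, forall x, a < x <= b -> w x - w a = \int[mu]_(y in `]a, x]) k y} ->
  w b - w a = \int[mu]_(y in `]a, b]) k y ->
  m b * w b - m a * w a = \int[mu]_(x in `]a, b]) (m' x * w x + m x * k x).
Proof.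
move=> ab ik mw dm cm' wk wkb.
have mI : measurable `]a, b]%classic by exact: measurable_itv.
have sI : `]a, b] `<=` `[a, b]%classic.
  by move=> x /=; rewrite !in_itv/= => /andP[/ltW -> ->].
have im' : mu.-integrable `]a, b] (EFin \o m').
  apply: (@integrableS _ _ _ mu `[a, b]) => //.
  by apply: continuous_compact_integrable => //; exact: segment_compact.
pose f1 := m' \_ `]a, b]; pose f2 := k \_ `]a, b].
have if1 : mu.-integrable setT (EFin \o f1).
  by rewrite -restrict_EFin -integrable_mkcond.
have if2 : mu.-integrable setT (EFin \o f2).
  by rewrite -restrict_EFin -integrable_mkcond.
have [itri tri] := fubini_triangle _ _ if1 if2.
have e1 x : a < x <= b ->
    (\int[mu]_(y in `]-oo, x]) (f2 y)%:E = (\int[mu]_(y in `]a, x]) k y)%:E)%E.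
  move=> /andP[ax xb]; rewrite /Rintegral fineK.
    rewrite [LHS]integral_mkcond [RHS]integral_mkcond; apply: eq_integral => y _.
    rewrite !patchE/= !mem_setE !in_itv/= /f2 patchE mem_setE in_itv/=.
    case: (leP y x) => [yx|]; last by rewrite andbF.
    by rewrite (le_trans yx xb) !andbT; case: ifP.
  apply: (@integrable_fin_num _ _ _ mu) => //; apply: integrableS ik => //.
  by move=> y /=; rewrite !in_itv/= => /andP[-> yx]; exact: le_trans xb.
have e2 y : a < y <= b ->
    (\int[mu]_(x in `[y, +oo[) (f1 x)%:E = (m b - m y)%:E)%E.
  move=> /andP[ay yb].
  have dmy x : y <= x <= b -> is_derive x 1 m (m' x).
    by move=> /andP[yx xb]; apply: dm; rewrite xb (le_trans (ltW ay)).
  have cmy : {within `[y, b], continuous m'}.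
    apply: continuous_subspaceW cm' => x /=; rewrite !in_itv/= => /andP[yx ->].
    by rewrite andbT (le_trans (ltW ay)).
  rewrite -(FTC2_is_derive _ _ _ _ yb dmy cmy).
  rewrite [LHS]integral_mkcond [RHS]integral_mkcond; apply: eq_integral => x _.
  rewrite !patchE/= !mem_setE !in_itv/= /f1 patchE mem_setE in_itv/= andbT.
  case: (leP y x) => [yx|//]; rewrite (lt_le_trans ay yx)/=.
  by case: ifP.
have mk : measurable_fun `]a, b] k by have /integrableP[/measurable_EFinP] := ik.
have mm' : measurable_fun `]a, b] m' by have /integrableP[/measurable_EFinP] := im'.
(* [W] agrees a.e. with [w - w a]; Fubini's theorem makes [m' W] integrable. *)
pose W x := \int[mu]_(y in `]a, x]) k y.
have iW : mu.-integrable `]a, b] (fun x => (m' x * W x)%:E).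
  apply: (@eq_integrable _ _ _ mu _ mI _ _ _ (@integrableS _ _ _ mu _ _ _ measurableT mI _ itri)) => //.
  move=> x; rewrite inE/= => xab; have := xab; rewrite in_itv/= => xab'.
  by rewrite e1// EFinM /f1 patchE mem_set.
have cm : {within `[a, b], continuous m}.
  apply: derivable_within_continuous => x; rewrite in_itv/= => xab.
  by have [] := dm x xab.
have mm : measurable_fun `]a, b] m.
  apply: (@measurable_funS _ _ _ _ `[a, b]) => //.
  by apply: subspace_continuous_measurable_fun => //; exact: measurable_itv.
have [M mM] := within_continuous_bounded _ _ _ cm.
have ikm : mu.-integrable `]a, b] (fun x => (k x * m x)%:E).
  apply: (integrable_mul_bounded _ _ _ M) => // x /sI/=.
  by rewrite in_itv/=; exact: mM.
have ikb : mu.-integrable `]a, b] (fun x => (m b * k x)%:E).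
  exact: (@integrableZl _ _ _ mu _ mI (m b) _ ik).
have im'a : mu.-integrable `]a, b] (fun x => (w a * m' x)%:E).
  exact: (@integrableZl _ _ _ mu _ mI (w a) _ im').
have WE : \int[mu]_(x in `]a, b]) (m' x * W x) =
    m b * (w b - w a) - \int[mu]_(x in `]a, b]) (k x * m x).
  rewrite wkb -RintegralZl// -RintegralB//; congr fine.
  transitivity (\int[mu]_y ((f2 y)%:E * \int[mu]_(x in `[y, +oo[) (f1 x)%:E))%E.
    rewrite -tri integral_mkcond; apply: eq_integral => x _.
    rewrite patchE mem_setE /f1 patchE mem_setE in_itv/=; case: ifP => xab.
      by rewrite e1.
    by rewrite mul0e.
  rewrite [RHS]integral_mkcond; apply: eq_integral => y _.
  rewrite patchE mem_setE /f2 patchE mem_setE in_itv/=; case: ifP => yab.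
    by rewrite e2// -EFinM; congr EFin; ring.
  by rewrite mul0e.
have m'E : \int[mu]_(x in `]a, b]) (w a * m' x) = w a * (m b - m a).
  rewrite RintegralZl//; congr (_ * _); rewrite Rintegral_itv_obnd_cbnd//.
  by rewrite /Rintegral (FTC2_is_derive _ _ _ _ (ltW ab) dm cm').
have i1 : mu.-integrable `]a, b] (fun x => (m' x * W x + w a * m' x)%:E).
  exact: (@integrableD _ _ _ mu _ mI _ _ iW im'a).
have i2 : mu.-integrable `]a, b] (fun x => (m' x * W x + w a * m' x + k x * m x)%:E).
  exact: (@integrableD _ _ _ mu _ mI _ _ i1 ikm).
have -> : \int[mu]_(x in `]a, b]) (m' x * w x + m x * k x) =
    \int[mu]_(x in `]a, b]) (m' x * W x + w a * m' x + k x * m x).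
  congr fine; apply: (@ae_eq_integral _ _ _ mu) => //.
  - by apply/measurable_EFinP; apply: measurable_funD; exact: measurable_funM.
  - by have /integrableP[] := i2.
  - move: wk; apply: filterS; first exact: (ae_filter_ringOfSetsType mu).
    move=> x wx /=; rewrite in_itv/= => xab.
    by rewrite /W -wx//; congr EFin; ring.
rewrite (@RintegralD _ _ _ mu _ _ _ mI i1 ikm).
by rewrite (@RintegralD _ _ _ mu _ _ _ mI iW im'a) m'E WE; ring.
Qed.

End ProductRule.

(** * Integrals of powers, and Hardy's inequality *)

Section PowerIntegrals.
Context {R : realType}.
Local Notation mu := (@lebesgue_measure R).
Implicit Types (x y r c : R).

Lemma is_derive_powR r x : 0 < x ->
  is_derive x 1 (fun t => t `^ r / r) (r * x `^ (r - 1) / r).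
Proof.
move=> x0; have d := is_derive1_powR r x0.
have dc : is_derive x 1 (cst r^-1 : R -> R) 0 := is_derive_cst _ _ _.
have := is_deriveM d dc; rewrite scaler0 add0r /GRing.scale/= => dM; rewrite [_ / r]mulrC.
exact: dM.
Qed.

Lemma powR_within_continuous r (p q : R) : 0 < p ->
  {within `[p, q], continuous (fun t => t `^ r)}.
Proof.
move=> p0; apply: derivable_within_continuous => x; rewrite in_itv/= => /andP[px _].
by have [] := is_derive1_powR r (lt_le_trans p0 px).
Qed.

Lemma integral_powR r (p q : R) : r != 0 -> 0 < p -> p <= q ->
  (\int[mu]_(t in `[p, q]) (t `^ (r - 1))%:E = ((q `^ r - p `^ r) / r)%:E)%E.
Proof.
move=> r0 p0 pq.
have d x : p <= x <= q -> is_derive x 1 (fun t => t `^ r / r) (x `^ (r - 1)).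
  move=> /andP[px _]; have := is_derive_powR r x (lt_le_trans p0 px).
  by rewrite mulrAC divff// mul1r.
rewrite (FTC2_is_derive _ _ _ _ pq d); first by rewrite mulrBl.
exact: powR_within_continuous.
Qed.

(** Reduces improper integrals to integrals over compact intervals. *)
Lemma ge0_integral_exhaust (D : set R) (F : nat -> set R) (f : R -> \bar R) C :
  (forall m n, (m <= n)%N -> F m `<=` F n) -> (forall n, measurable (F n)) ->
  \bigcup_n F n = D -> measurable_fun D f -> (forall x, D x -> 0 <= f x)%E ->
  (forall n, \int[mu]_(x in F n) f x <= C)%E -> (\int[mu]_(x in D) f x <= C)%E.
Proof.
move=> ndF mF <- mf f0 FC.
have h : (\int[mu]_(x in F i) f x)%E @[i --> \oo] -->
    (\int[mu]_(x in \bigcup_i F i) f x)%E.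
  apply: (@ge0_nondecreasing_set_cvg_integral _ _ _ _ _ mu) => //.
  - by move=> m n mn; apply/subsetPset; exact: ndF.
  - move=> n; apply: measurable_funS mf; last by move=> x Fx; exists n.
    exact: bigcup_measurable.
  - by move=> n x Fx; apply: f0; exists n.
rewrite -(cvg_lim _ h)//; apply: lime_le; last exact: nearW.
by apply/cvg_ex; eexists; exact: h.
Qed.

Let measurable_powRT r (D : set R) : measurable_fun D (fun x => (x `^ r)%:E).
Proof. by apply/measurable_EFinP/measurable_funTS; exact: measurable_powR. Qed.

Lemma integral_powR_0 r x : 0 < r -> 0 < x ->
  (\int[mu]_(t in `]0%R, x]) (t `^ (r - 1))%:E <= (x `^ r / r)%:E)%E.
Proof.
move=> r0 x0; apply: (@ge0_integral_exhaust _ (fun n => `[x / n.+1%:R, x]%classic)) => //.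
- move=> m n mn t /=; rewrite !in_itv/= => /andP[xt ->]; rewrite andbT.
  by rewrite (le_trans _ xt)// ler_wpM2l ?(ltW x0)// lef_pV2 ?posrE ?ltr0n// ler_nat ltnS.
- apply/seteqP; split => t /=.
    move=> [n _] /=; rewrite !in_itv/= => /andP[xt ->]; rewrite andbT.
    by rewrite (lt_le_trans _ xt)// divr_gt0.
  rewrite in_itv/= => /andP[t0 tx]; exists (Num.truncn (x / t)) => //=.
  rewrite in_itv/= tx andbT ler_pdivrMr ?ltr0n// mulrC -ler_pdivrMr//.
  by rewrite ltW// truncnS_gt.
- by move=> t _; rewrite lee_fin powR_ge0.
move=> n; rewrite integral_powR ?gt_eqF ?divr_gt0//.
  by rewrite lee_fin ler_pM2r ?invr_gt0// gerBl powR_ge0.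
by rewrite ler_pdivrMr ?ltr0n// ler_peMr ?ler1n// ltW.
Qed.

Lemma integral_powR_y c y : 0 < c -> 0 < y ->
  (\int[mu]_(t in `[y, +oo[) (t `^ (- c - 1))%:E <= (y `^ (- c) / c)%:E)%E.
Proof.
move=> c0 y0; apply: (@ge0_integral_exhaust _ (fun n => `[y, y + n%:R]%classic)) => //.
- move=> m n mn t /=; rewrite !in_itv/= => /andP[-> yt]/=.
  by rewrite (le_trans yt)// lerD2l ler_nat.
- apply/seteqP; split => t /=.
    by move=> [n _] /=; rewrite !in_itv/= => /andP[->].
  rewrite in_itv/= andbT => yt; exists (Num.truncn (t - y)).+1 => //=.
  by rewrite in_itv/= yt/= -lerBlDl ltW// truncnS_gt.
- by move=> t _; rewrite lee_fin powR_ge0.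
move=> n; rewrite integral_powR ?oppr_eq0 ?gt_eqF ?lerDl//.
rewrite lee_fin invrN mulrN -mulNr opprB ler_pM2r ?invr_gt0//.
by rewrite gerBl powR_ge0.
Qed.

End PowerIntegrals.

Section Hardy.
Context {R : realType}.
Local Notation mu := (@lebesgue_measure R).
Implicit Types (G : R -> R) (x y r s : R).

Lemma measurable_abse_poweR (f : R -> \bar R) r : measurable_fun setT f ->
  measurable_fun setT (fun x => (`|f x| `^ r)%E).
Proof.
move=> mf; have mabs : measurable_fun setT (abse \o f) by exact: measurableT_comp.
exact: measurableT_comp (measurable_poweR r) mabs.
Qed.

Lemma le_poweR (a c : \bar R) r : 0 <= r -> (0 <= a -> a <= c ->
  a `^ r <= c `^ r)%E.
Proof.
move=> r0 a0 ac; apply: gt0_ler_poweR => //; rewrite in_itv/= leey andbT//.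
exact: le_trans ac.
Qed.

(** Extended-real valued, hence meaningful before [G] is known to be in [L^p]. *)
Definition hardy_primitive s G x : \bar R :=
  (\int[mu]_(t in `]0%R, x]) (t `^ (s - 1) * `|G t|)%:E)%E.

Lemma hardy_primitive_ge0 s G x : (0 <= hardy_primitive s G x)%E.
Proof.
by apply: integral_ge0 => t _; rewrite lee_fin mulr_ge0 ?powR_ge0.
Qed.

(** Hoelder's inequality for the splitting
    [t^(s-1) |G| = t^(s-1-b) * (t^b |G|)]; the first factor is in [L^q] near [0]
    exactly when [p^-1 + b < s]. *)
Lemma hardy_primitive_le (p q s b : R) G x :
  measurable_fun setT G -> 0 < p -> 0 < q -> p^-1 + q^-1 = 1 ->
  p^-1 + b < s -> 0 < x ->
  (hardy_primitive s G x `^ p <=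
   (((s - p^-1 - b) * q) `^ (- p / q) * x `^ ((s - p^-1 - b) * p))%:E *
   \int[mu]_(t in `]0%R, x]) (t `^ (b * p) * `|G t| `^ p)%:E)%E.
Proof.
move=> mG p0 q0 pq bs x0.
set d := s - p^-1 - b; have d0 : 0 < d by rewrite /d; lra.
(* the integrand [t^(d q - 1)] of the first factor has primitive [t^(d q) / (d q)] *)
have dq : (s - 1 - b) * q = d * q - 1.
  have q1 : q^-1 * q = 1 by rewrite mulVf// gt_eqF.
  have -> : s - 1 - b = d - q^-1 by rewrite /d -pq; ring.
  by rewrite mulrBl q1.
pose f1 := (fun t => t `^ (s - 1 - b)) \_ `]0, x].
pose f2 := (fun t => t `^ b * `|G t|) \_ `]0, x].
have mI : measurable `]0, x]%classic by exact: measurable_itv.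
have mf1 : measurable_fun setT f1.
  by apply/(measurable_restrictT _ _).1 => //; apply: measurable_funTS; exact: measurable_powR.
have mf2 : measurable_fun setT f2.
  apply/(measurable_restrictT _ _).1 => //; apply: measurable_funTS.
  apply: measurable_funM; first exact: measurable_powR.
  exact: measurableT_comp.
have := @hoelder _ _ _ mu f1 f2 q p mf1 mf2 q0 p0; rewrite addrC => /(_ pq).
have -> : ('N[mu]_1[EFin \o (f1 \* f2)%R] = hardy_primitive s G x)%E.
  rewrite Lnorm1 /hardy_primitive [RHS]integral_mkcond; apply: eq_integral => t _.
  rewrite /f1 /f2/= !patchE mem_setE in_itv/=.
  case: ifP => [/andP[t0 tx]|_]; last by rewrite mulr0 normr0.
  rewrite mulrA -powRD ?(gt_eqF t0) ?implybT// subrK.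
  by rewrite ger0_norm// mulr_ge0 ?powR_ge0.
move=> hA.
apply: (le_trans (le_poweR _ _ _ (ltW p0) (hardy_primitive_ge0 _ _ _) hA)).
rewrite poweRM ?Lnorm_ge0// poweR_Lnorm ?gt_eqF//.
apply: lee_pmul; [exact: poweR_ge0|by apply: integral_ge0 => t _; exact: poweR_ge0| |].
  have N1 : ('N[mu]_q%:E[EFin \o f1] `^ q <= (x `^ (d * q) / (d * q))%:E)%E.
    rewrite poweR_Lnorm ?gt_eqF//.
    apply: le_trans (integral_powR_0 (d * q) x _ x0); last by rewrite mulr_gt0.
    rewrite le_eqVlt; apply/orP; left; apply/eqP.
    rewrite [RHS]integral_mkcond; apply: eq_integral => t _.
    rewrite /f1/= !patchE mem_setE in_itv/=; case: ifP => [/andP[t0 tx]|_].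
      by rewrite ger0_norm ?powR_ge0// ?poweR_EFin -powRrM dq.
    by rewrite normr0 ?poweR_EFin powR0// gt_eqF.
  have pq0 : 0 <= p / q by rewrite divr_ge0 ?(ltW p0) ?(ltW q0).
  have := le_poweR _ _ _ pq0 (poweR_ge0 _ _) N1.
  rewrite -poweRrM mulrCA divff ?gt_eqF// mulr1 => /le_trans; apply.
  rewrite poweR_EFin lee_fin le_eqVlt; apply/orP; left; apply/eqP.
  rewrite powRM ?powR_ge0 ?invr_ge0 ?mulr_ge0 ?(ltW d0) ?(ltW q0)// mulrC.
  congr (_ * _).
    by rewrite mulNr powRN -[in LHS]powR_inv1 ?mulr_ge0 ?(ltW d0) ?(ltW q0)//
      -powRrM mulN1r powRN.
  by rewrite -powRrM; congr (_ `^ _); field; rewrite gt_eqF.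
rewrite le_eqVlt; apply/orP; left; apply/eqP.
rewrite [RHS]integral_mkcond; apply: eq_integral => t _.
rewrite /f2/= !patchE mem_setE in_itv/=; case: ifP => [/andP[t0 tx]|_].
  rewrite ger0_norm ?mulr_ge0 ?powR_ge0// ?poweR_EFin.
  by rewrite powRM ?powR_ge0// -powRrM.
by rewrite normr0 ?poweR_EFin powR0// gt_eqF.
Qed.


Lemma hardy_primitive_mkcond s G x : hardy_primitive s G x =
  (\int[mu]_(t in `]-oo, x]) (((fun t => t `^ (s - 1) * `|G t|) \_ Rpos) t)%:E)%E.
Proof.
rewrite /hardy_primitive integral_mkcond [RHS]integral_mkcond.
apply: eq_integral => t _; rewrite !patchE/= ?patchE !mem_setE !in_itv/= andbT.
by case: (0 < t); case: (t <= x).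
Qed.

Let mhardy s G : measurable_fun setT G ->
  measurable_fun setT ((fun t => t `^ (s - 1) * `|G t|) \_ Rpos).
Proof.
move=> mG; apply/(measurable_restrictT _ _).1; first exact: measurable_itv.
apply: measurable_funTS; apply: measurable_funM; first exact: measurable_powR.
exact: measurableT_comp.
Qed.

Lemma measurable_hardy_primitive s G : measurable_fun setT G ->
  measurable_fun setT (hardy_primitive s G).
Proof.
move=> mG; have -> : hardy_primitive s G = fun x =>
  (\int[mu]_(t in `]-oo, x]) (((fun t => t `^ (s - 1) * `|G t|) \_ Rpos) t)%:E)%E.
  by apply/funext => x; exact: hardy_primitive_mkcond.
apply: measurable_primitive; first exact: mhardy.
by move=> t; rewrite patchE; case: ifP => // _; rewrite mulr_ge0 ?powR_ge0.
Qed.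

Definition hardy_average s G x : \bar R :=
  if 0 < x then ((x `^ (- s))%:E * hardy_primitive s G x)%E else 0%E.

Lemma hardy_average_ge0 s G x : (0 <= hardy_average s G x)%E.
Proof.
rewrite /hardy_average; case: ifP => // _.
by rewrite mule_ge0 ?lee_fin ?powR_ge0 ?hardy_primitive_ge0.
Qed.

Lemma measurable_hardy_average s G : measurable_fun setT G ->
  measurable_fun setT (hardy_average s G).
Proof.
move=> mG; have -> : hardy_average s G = fun x =>
   ((((fun x => x `^ (- s)) \_ Rpos) x)%:E * hardy_primitive s G x)%E.
  apply/funext => x; rewrite /hardy_average patchE mem_setE in_itv/= andbT.
  by case: ifP => // _; rewrite mul0e.
apply: emeasurable_funM; last exact: measurable_hardy_primitive.
apply/measurable_EFinP/(measurable_restrictT _ _).1; first exact: measurable_itv.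
by apply: measurable_funTS; exact: measurable_powR.
Qed.

(** The exponent [b] of the auxiliary weight lies strictly between [0] and
    [s - 1/p]: below [s - 1/p] for Hoelder's inequality near [0], above [0]
    so that, after Tonelli, [x^(-b p - 1)] is integrable at infinity. *)
Lemma hardy_finite (p s : R) : 1 < p -> p^-1 < s ->
  exists2 C, 0 <= C & forall G, measurable_fun setT G ->
  ('N[mu]_p%:E[hardy_average s G] <= C%:E * normp_Rpos p%:E G)%E.
Proof.
move=> p1 ps; have p0 : 0 < p by rewrite (lt_trans _ p1).
pose q := (1 - p^-1)^-1.
have p1' : 0 < 1 - p^-1 by rewrite subr_gt0 invf_lt1.
have q0 : 0 < q by rewrite invr_gt0.
have pq : p^-1 + q^-1 = 1 by rewrite invrK addrC subrK.
pose b := (s - p^-1) / 2.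
have b0 : 0 < b by rewrite divr_gt0// subr_gt0.
have bs : p^-1 + b < s by rewrite /b; lra.
pose d := s - p^-1 - b.
pose K := (d * q) `^ (- p / q).
have bp0 : 0 < b * p by rewrite mulr_gt0.
pose C := K / (b * p).
have C0 : 0 <= C by rewrite divr_ge0 ?powR_ge0 ?(ltW bp0).
exists (C `^ p^-1); first exact: powR_ge0.
move=> G mG.
pose f1 := (fun x => x `^ (- (b * p) - 1)) \_ (Rpos : set R).
pose f2 := (fun t => t `^ (b * p) * `|G t| `^ p) \_ (Rpos : set R).
have mRpos : measurable (Rpos : set R) by exact: measurable_itv.
have mf1 : measurable_fun setT f1.
  apply/(measurable_restrictT _ _).1 => //; apply: measurable_funTS.
  exact: measurable_powR.
have mGp : measurable_fun setT (fun t => `|G t| `^ p).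
  apply: (@measurableT_comp _ _ _ _ _ _ (fun t => t `^ p)); first exact: measurable_powR.
  exact: measurableT_comp.
have mf2 : measurable_fun setT f2.
  apply/(measurable_restrictT _ _).1 => //; apply: measurable_funTS.
  by apply: measurable_funM => //; exact: measurable_powR.
have f10 x : 0 <= f1 x by rewrite /f1 patchE; case: ifP => // _; exact: powR_ge0.
have f20 x : 0 <= f2 x.
  by rewrite /f2 patchE; case: ifP => // _; rewrite mulr_ge0 ?powR_ge0.
have step1 : (\int[mu]_x (`|hardy_average s G x| `^ p) <=
   \int[mu]_x (K%:E * ((f1 x)%:E * \int[mu]_(t in `]-oo, x]) (f2 t)%:E)))%E.
  apply: ge0_le_integral => //.
  - by move=> x _; exact: poweR_ge0.
  - by apply: measurable_abse_poweR; exact: measurable_hardy_average.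
  - apply: emeasurable_funM => //; apply: emeasurable_funM.
      exact/measurable_EFinP.
    exact: measurable_primitive.
  move=> x _; rewrite gee0_abs ?hardy_average_ge0// /hardy_average; case: ifP => x0; last first.
    by rewrite poweR_EFin powR0 ?gt_eqF// mule_ge0 ?lee_fin ?powR_ge0// mule_ge0 ?lee_fin//
      integral_ge0// => t _; rewrite lee_fin.
  rewrite poweRM ?lee_fin ?powR_ge0 ?hardy_primitive_ge0//.
  have := hardy_primitive_le p q s b G x mG p0 q0 pq bs x0; rewrite -/d -/K => hp.
  apply: (le_trans (lee_wpmul2l (poweR_ge0 _ _) hp)).
  have -> : (\int[mu]_(t in `]0%R, x]) (t `^ (b * p) * `|G t| `^ p)%:E =
     \int[mu]_(t in `]-oo, x]) (f2 t)%:E)%E.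
    rewrite integral_mkcond [RHS]integral_mkcond; apply: eq_integral => t _.
    rewrite /f2 !patchE/= ?patchE !mem_setE !in_itv/= andbT.
    by case: (0 < t); case: (t <= x).
  rewrite muleA muleA poweR_EFin -EFinM -EFinM le_eqVlt; apply/orP; left.
  apply/eqP; congr ((_%:E) * _)%E; rewrite /f1 patchE mem_setE in_itv/= x0/=.
  rewrite mulrCA -powRrM -powRD ?(gt_eqF x0) ?implybT//; congr (_ * _ `^ _).
  by rewrite /d; field; rewrite gt_eqF.
have step2 : (\int[mu]_x (K%:E * ((f1 x)%:E * \int[mu]_(t in `]-oo, x]) (f2 t)%:E)) <=
    C%:E * \int[mu]_x (`|(EFin \o (G \_ Rpos)) x| `^ p))%E.
  rewrite ge0_integralZl//; last 3 first.
  - by apply: emeasurable_funM; [exact/measurable_EFinP|exact: measurable_primitive].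
  - by move=> x _; rewrite mule_ge0 ?lee_fin// integral_ge0// => t _; rewrite lee_fin.
  - by rewrite lee_fin powR_ge0.
  rewrite tonelli_triangle// /C EFinM -muleA.
  apply: lee_wpmul2l; first by rewrite lee_fin powR_ge0.
  have mG0 : measurable_fun setT (G \_ Rpos).
    by apply/(measurable_restrictT _ _).1 => //; exact: measurable_funTS.
  have mG0p : measurable_fun setT (fun x => (`|(EFin \o (G \_ Rpos)) x| `^ p)%E).
    by apply: measurable_abse_poweR; exact/measurable_EFinP.
  rewrite -ge0_integralZl//; last 2 first.
  - by move=> x _; exact: poweR_ge0.
  - by rewrite lee_fin invr_ge0 ltW.
  apply: ge0_le_integral => //.
  - move=> y _; rewrite mule_ge0 ?lee_fin//; apply: integral_ge0 => t _.
    by rewrite lee_fin.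
  - apply: emeasurable_funM; first exact/measurable_EFinP.
    exact: measurable_coprimitive.
  - by apply: emeasurable_funM; [exact: measurable_cst|exact: mG0p].
  move=> y _; rewrite /f2 patchE mem_setE in_itv/= andbT; case: ifP => y0; last first.
    by rewrite mul0e mule_ge0 ?poweR_ge0// lee_fin invr_ge0 ltW.
  rewrite patchE mem_setE in_itv/= y0/= ?poweR_EFin.
  have fE : (\int[mu]_(x in `[y, +oo[) (f1 x)%:E =
             \int[mu]_(x in `[y, +oo[) (x `^ (- (b * p) - 1))%:E)%E.
    apply: eq_integral => x; rewrite inE/= in_itv/= andbT => yx.
    by rewrite /f1 patchE mem_setE in_itv/= (lt_le_trans y0 yx).
  rewrite fE; apply: le_trans.
    apply: lee_wpmul2l (integral_powR_y _ _ bp0 y0).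
    by rewrite lee_fin mulr_ge0 ?powR_ge0.
  rewrite -!EFinM lee_fin le_eqVlt; apply/orP; left; apply/eqP.
  have yy : y `^ (b * p) * y `^ (- (b * p)) = 1.
    by rewrite -powRD ?(gt_eqF y0) ?implybT// subrr powRr0.
  by rewrite mulrACA mulrCA mulrA yy; ring.
rewrite /normp_Rpos unlock /=.
apply: le_trans.
  apply: le_poweR; [by rewrite invr_ge0 ltW| |exact: le_trans step1 step2].
  by apply: integral_ge0 => x _; exact: poweR_ge0.
rewrite poweRM ?poweR_EFin//.
by apply: integral_ge0 => x _; exact: poweR_ge0.
Qed.

Lemma lebesgue_measureT_gt0 : (0 < mu setT)%E.
Proof.
apply: (@lt_le_trans _ _ (mu `[0, 1]%classic)).
  by rewrite lebesgue_measure_itv/= lte_fin ltr01 sube0 lte_fin.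
by apply: le_measure; rewrite ?inE//; exact: measurable_itv.
Qed.

(** [|G|] is bounded a.e. on the half-line and [int_0^x t^(s-1) dt = x^s / s]. *)
Lemma hardy_infty (s : R) : 0 < s ->
  forall G, measurable_fun setT G ->
  ('N[mu]_+oo[hardy_average s G] <= (s^-1)%:E * normp_Rpos +oo G)%E.
Proof.
move=> s0 G mG; rewrite /normp_Rpos; set N := ('N[mu]_+oo[EFin \o G \_ Rpos])%E.
have muT : (0 < mu setT)%E := lebesgue_measureT_gt0.
have N0 : (0 <= N)%E by exact: Lnorm_ge0.
have GN : {ae mu, forall x, (`|(G \_ Rpos) x|%:E <= N)%E}.
  have := ess_sup_ge mu (abse \o (EFin \o (G \_ Rpos))).
  apply: (@filterS _ _ (ae_filter_ringOfSetsType mu)).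
  by move=> x /=; rewrite /N unlock muT.
rewrite unlock muT; apply/ess_supP.
have [Ny|] := eqVneq N +oo%E.
  by rewrite Ny gt0_muley ?lte_fin ?invr_gt0//; apply: aeW => x; rewrite leey.
move=> Ny; have Nfin : N \is a fin_num by rewrite ge0_fin_numE// ltey.
move: GN N0; rewrite -(fineK Nfin); set n := fine N => GN n0.
apply: aeW => x /=; rewrite gee0_abs ?hardy_average_ge0// /hardy_average.
rewrite lee_fin in n0.
case: ifP => x0; last by rewrite -EFinM lee_fin mulr_ge0// invr_ge0 ltW.
have : (hardy_primitive s G x <= n%:E * (x `^ s / s)%:E)%E.
  apply: le_trans; last exact: lee_wpmul2l (integral_powR_0 s x s0 x0).
  rewrite -ge0_integralZl//; last 2 first.
  - by apply/measurable_EFinP/measurable_funTS; exact: measurable_powR.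
  - by move=> t _; rewrite lee_fin powR_ge0.
  have mI : measurable `]0, x]%classic by exact: measurable_itv.
  apply: (@ae_ge0_le_integral _ _ _ mu _ mI).
  - by move=> t _; rewrite lee_fin mulr_ge0 ?powR_ge0.
  - apply/measurable_EFinP/measurable_funTS; apply: measurable_funM.
      exact: measurable_powR.
    exact: measurableT_comp.
  - by move=> t _; rewrite -EFinM lee_fin mulr_ge0 ?powR_ge0.
  - apply: emeasurable_funM => //; apply/measurable_EFinP/measurable_funTS.
    exact: measurable_powR.
  move: GN; apply: filterS; first exact: (ae_filter_ringOfSetsType mu).
  move=> t /= Gt /=; rewrite in_itv/= => /andP[t0 tx].
  rewrite -EFinM lee_fin mulrC ler_wpM2r ?powR_ge0//.
  by move: Gt; rewrite lee_fin patchE mem_setE in_itv/= t0.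
move=> hp; apply: (le_trans (lee_wpmul2l _ hp)); first by rewrite lee_fin powR_ge0.
rewrite -!EFinM lee_fin le_eqVlt; apply/orP; left; apply/eqP.
have xx : x `^ (- s) * x `^ s = 1.
  by rewrite -powRD ?(gt_eqF x0) ?implybT// addNr powRr0.
by rewrite mulrCA [_ * (_ / _)]mulrA xx; ring.
Qed.

Lemma Lnorm_ae_le (p : \bar R) (f F : R -> \bar R) C :
  (0 < p)%E -> 0 <= C -> measurable_fun setT f -> measurable_fun setT F ->
  {ae mu, forall x, (`|f x| <= C%:E * `|F x|)%E} ->
  ('N[mu]_p[f] <= C%:E * 'N[mu]_p[F])%E.
Proof.
case: p => [p| |]//; rewrite ?lte_fin => p0 C0 mf mF fF.
  have pV0 : 0 <= p^-1 by rewrite invr_ge0 ltW.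
  have CE : (C%:E = (C%:E `^ p) `^ p^-1)%E.
    by rewrite -poweRrM divff ?gt_eqF// poweRe1.
  rewrite unlock [in leRHS]CE -poweRM ?poweR_ge0//; last first.
    by apply: integral_ge0 => x _; exact: poweR_ge0.
  apply: le_poweR => //; first by apply: integral_ge0 => x _; exact: poweR_ge0.
  rewrite poweR_EFin -ge0_integralZl//; last 3 first.
  - exact: measurable_abse_poweR.
  - by move=> x _; exact: poweR_ge0.
  - by rewrite lee_fin powR_ge0.
  apply: (@ae_ge0_le_integral _ _ _ mu _ measurableT).
  - by move=> x _; exact: poweR_ge0.
  - exact: measurable_abse_poweR.
  - by move=> x _; rewrite mule_ge0 ?poweR_ge0// lee_fin powR_ge0.
  - by apply: emeasurable_funM; [exact: measurable_cst|exact: measurable_abse_poweR].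
  move: fF; apply: filterS; first exact: (ae_filter_ringOfSetsType mu).
  move=> x fx _; rewrite -poweR_EFin -poweRM ?lee_fin//.
  exact: le_poweR (ltW p0) _ fx.
rewrite unlock lebesgue_measureT_gt0; apply/ess_supP.
suff H : {ae mu, forall x, (`|f x| <= C%:E * ess_sup mu (abse \o F))%E}.
  exact: H.
have := @filterI _ _ (ae_filter_ringOfSetsType mu) _ _ fF (ess_sup_ge mu (abse \o F)).
apply: (@filterS _ _ (ae_filter_ringOfSetsType mu)).
by move=> x /= [fx Fx]; apply: (le_trans fx); exact: lee_wpmul2l.
Qed.

Lemma hardy (p : \bar R) (s : R) : (1 < p)%E -> (p^-1 < s%:E)%E ->
  exists2 C, 0 <= C & forall G, measurable_fun setT G ->
  ('N[mu]_p[hardy_average s G] <= C%:E * normp_Rpos p G)%E.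
Proof.
case: p => [p| |]//; rewrite ?lte_fin.
  move=> p1; rewrite inver gt_eqF ?lte_fin; last exact: lt_trans p1.
  exact: hardy_finite.
move=> _ s0; exists s^-1; first by rewrite invr_ge0 ltW.
exact: hardy_infty.
Qed.

End Hardy.

(** * The weight near the origin *)

Section C1HalfLine.
Context {R : realType}.
Implicit Types (f h : R -> R) (x a : R).
Local Notation Ici := (`[0%R, +oo[%classic : set R).

Lemma is_derive_quotient f x d :
  (f y - f x) / (y - x) @[y --> x^'] --> d -> is_derive x 1 f d.
Proof.
move=> fd; apply: is_derive_cvg.
have sh : h + x @[h --> (0 : R)^'] --> x^'.
  move=> P /nbhs_ballP[e /= e0 Pe]; apply/nbhs_ballP; exists e => //= y.
  rewrite /ball/= sub0r normrN => ye y0; apply: Pe.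
    by rewrite /ball/= opprD addrCA subrr addr0 normrN.
  by apply: contra y0 => /eqP; rewrite -[RHS]add0r => /addIr ->.
have := cvg_comp _ _ sh fd; apply: cvg_trans; apply: near_eq_cvg.
by near=> y; rewrite /= addrK mulrC.
Unshelve. all: by end_near. Qed.

Lemma C1_on_is_derive h x : C1_on Ici h -> 0 < x ->
  is_derive x 1 h (derive1_within Ici h x).
Proof.
move=> [hcvg _] x0; apply: is_derive_quotient.
have xI : Ici x by rewrite /= in_itv/= andbT ltW.
suff wE : within Ici x^' = x^' by have := hcvg _ xI; rewrite /derive1_within /quotient_within wE.
apply/funext => P; apply/propext; split.
  move=> wP; have nI : \forall y \near x, Ici y.
    have : x \in `]0, +oo[ by rewrite in_itv/= x0.
    by move=> /near_in_itvoy; apply: filterS => y; rewrite /= !in_itv/= !andbT => /ltW.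
  near=> y.
  have : Ici y -> P y by near: y; exact: wP.
  by apply; near: y; apply: nbhs_dnbhs.
by move=> xP; apply: filterS xP => y Py _.
Unshelve. all: by end_near. Qed.

Lemma C1_on_continuous_derive1 h x : C1_on Ici h -> 0 < x ->
  {for x, continuous (derive1 h)}.
Proof.
move=> hC1 x0; have [_ c] := hC1.
have cx : {for x, continuous (derive1_within Ici h)}.
  apply: (@within_continuous_continuous _ _ _ (x / 2) (x + 1)).
  - by rewrite (@lt_trans _ _ x)// ?ltrDl// ltr_pdivrMr// ltr_pMr// ltr1n.
  - apply: continuous_subspaceW c => y /=; rewrite !in_itv/= => /andP[xy _].
    by rewrite andbT (le_trans _ xy)// divr_ge0// ltW.
  - by rewrite in_itv/= ltrDl ltr01 andbT ltr_pdivrMr// ltr_pMr// ltr1n.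
have cx' : derive1_within Ici h y @[y --> x] --> derive1_within Ici h x := cx.
have E y : 0 < y -> derive1 h y = derive1_within Ici h y.
  by move=> y0; have d := C1_on_is_derive _ _ hC1 y0; rewrite derive1E derive_val.
rewrite /prop_for /continuous_at E//; apply: cvg_trans cx'; apply: near_eq_cvg.
have : x \in `]0, +oo[ by rewrite in_itv/= x0.
by move=> /near_in_itvoy; apply: filterS => y; rewrite in_itv/= andbT => /E.
Qed.

Lemma C1_on_derive1 h x : C1_on Ici h -> 0 < x ->
  is_derive x 1 h (derive1 h x).
Proof.
move=> hC1 x0; have d := C1_on_is_derive _ _ hC1 x0.
by rewrite derive1E derive_val.
Qed.

Lemma C1_on_continuous h x : C1_on Ici h -> 0 < x -> {for x, continuous h}.
Proof.
by move=> hC1 x0; apply: is_derive_continuous; exact: C1_on_derive1.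
Qed.

(** Near [0] the quotient [h x / x] is close to [h' 0 > 0]; away from [0] the
    function is continuous and positive on a compact interval. *)
Lemma C1_on_comparable h (X : R) : C1_on Ici h -> h 0 = 0 ->
  0 < derive1_within Ici h 0 -> (forall x, 0 < x -> 0 < h x) -> 0 < X ->
  exists c C, [/\ 0 < c, 0 < C & forall x, 0 < x <= X -> c * x <= h x <= C * x].
Proof.
move=> hC1 h0 d0 hp X0; set d := derive1_within Ici h 0 in d0.
have I0 : Ici 0 by rewrite /= in_itv/= lexx.
have hd : quotient_within Ici h 0 --> d by have [+ _] := hC1; apply.
have d2 : \forall y \near within Ici 0^', `|d - (h y - h 0) / (y - 0)| < d / 2.
  by move/cvgrPdist_lt : hd; apply; rewrite divr_gt0.
have [e /= e0 he] : exists2 e, 0 < e & forall y, 0 < y < e -> d / 2 * y <= h y <= 2 * d * y.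
  have [e /= e0 he] := d2; exists e => // y /andP[y0 ye].
  have := he y; rewrite /ball/= sub0r normrN gtr0_norm// in_itv/= andbT (gt_eqF y0) (ltW y0).
  move=> /(_ ye isT isT); rewrite h0 !subr0 ltr_norml => /andP[h1 h2].
  have h3 : h y / y * y = h y by rewrite mulfVK// gt_eqF.
  rewrite -h3; apply/andP; split; rewrite ler_wpM2r ?(ltW y0)//; lra.
pose a := Num.min (e / 2) X.
have a0 : 0 < a by rewrite lt_min X0 divr_gt0.
have aX : a <= X by rewrite ge_min lexx orbT.
have ae : a < e.
  by rewrite (@le_lt_trans _ _ (e / 2)) ?ge_min ?lexx// ltr_pdivrMr// ltr_pMr// ltr1n.
have ch : {within `[a, X], continuous h}.
  apply: derivable_within_continuous => x; rewrite in_itv/= => /andP[ax _].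
  by have [] := C1_on_derive1 _ _ hC1 (lt_le_trans a0 ax).
have [x1 x1a hx1] := EVT_min aX ch.
have [x2 x2a hx2] := EVT_max aX ch.
have h10 : 0 < h x1.
  by apply: hp; move: x1a; rewrite in_itv/= => /andP[/(lt_le_trans a0)].
have h20 : 0 < h x2.
  by apply: hp; move: x2a; rewrite in_itv/= => /andP[/(lt_le_trans a0)].
exists (Num.min (d / 2) (h x1 / X)), (Num.max (2 * d) (h x2 / a)); split.
- by rewrite lt_min !divr_gt0.
- by rewrite lt_max mulr_gt0.
move=> x /andP[x0 xX]; have [xe|ax] := ltP x a.
  have /andP[l r] : d / 2 * x <= h x <= 2 * d * x by apply: he; rewrite x0 (lt_trans xe).
  apply/andP; split.
    by apply: le_trans l; rewrite ler_wpM2r ?(ltW x0)// ge_min lexx.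
  by apply: (le_trans r); rewrite ler_wpM2r ?(ltW x0)// le_max lexx.
have xI : x \in `[a, X] by rewrite in_itv/= ax.
apply/andP; split.
  apply: le_trans (hx1 _ xI); apply: (@le_trans _ _ (h x1 / X * x)).
    by rewrite ler_wpM2r ?(ltW x0)// ge_min lexx orbT.
  by rewrite mulrAC ler_pdivrMr// ler_wpM2l// ltW.
apply: (le_trans (hx2 _ xI)); apply: (@le_trans _ _ (h x2 / a * x)).
  by rewrite mulrAC ler_pdivlMr// ler_wpM2l// ltW.
by rewrite ler_wpM2r ?(ltW x0)// le_max lexx orbT.
Qed.

End C1HalfLine.

Section PowerComparison.
Context {R : realType}.

(** The constant is [C^r] or [c^r] according to the sign of [r]. *)
Lemma powR_comparable (c C r : R) : 0 < c -> 0 < C ->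
  exists2 K, 0 < K & forall x y : R, 0 < x -> c * x <= y <= C * x ->
    y `^ r <= K * x `^ r.
Proof.
move=> c0 C0; have [r0|r0] := leP 0 r.
  exists (C `^ r); first exact: powR_gt0.
  move=> x y x0 /andP[cy yC]; rewrite -powRM ?(ltW C0) ?(ltW x0)//.
  apply: ge0_ler_powR => //; rewrite ?nnegrE ?mulr_ge0 ?(ltW C0) ?(ltW x0)//.
  by rewrite (le_trans _ cy)// mulr_ge0// ltW.
exists (c `^ r); first exact: powR_gt0.
move=> x y x0 /andP[cy yC]; rewrite -powRM ?(ltW c0) ?(ltW x0)//.
have cx0 : 0 < c * x by rewrite mulr_gt0.
have y0 : 0 < y by rewrite (lt_le_trans _ cy).
rewrite -(opprK r) ![_ `^ (- - r)]powRN lef_pV2 ?posrE ?powR_gt0//.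
by apply: ge0_ler_powR => //; rewrite ?nnegrE ?oppr_ge0 ltW.
Qed.

End PowerComparison.

(** * Locally integrable functions and test functions *)

Section LocallyIntegrable.
Context {R : realType}.
Local Notation mu := (@lebesgue_measure R).
Implicit Types (f c phi : R -> R) (D K : set R).

Lemma continuous_in_bounded c D K : {in D, continuous c} -> K `<=` D -> compact K ->
  exists M, forall x, K x -> `|c x| <= M.
Proof.
move=> cc KD cK.
have cK' : {within K, continuous c}.
  by apply: continuous_in_subspaceT => x xK; apply: cc; rewrite inE; apply: KD; rewrite inE in xK.
have /compact_bounded[M [_ cM]] := continuous_compact cK' cK.
by exists (M + 1) => x Kx; apply: cM; [rewrite ltrDl|exists x].
Qed.

Lemma locally_integrable_compact D K f : locally_integrable D f ->
  K `<=` D -> compact K -> mu.-integrable K (EFin \o f).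
Proof.
move=> [mf oD fK] KD cK; apply/integrableP; split; last exact: fK.
apply/measurable_EFinP; apply: measurable_funS mf => //.
exact: open_measurable.
Qed.

Lemma locally_integrableM D f c : locally_integrable D f ->
  {in D, continuous c} -> locally_integrable D (f \* c).
Proof.
move=> fl cc; have [mf oD fK] := fl.
have mc : measurable_fun D c by exact: open_continuous_measurable_fun.
split => //; first exact: measurable_funM.
move=> K KD cK; have iK := locally_integrable_compact _ _ _ fl KD cK.
have [M cM] := continuous_in_bounded _ _ _ cc KD cK.
have mK := compact_measurable cK.
have mcK : measurable_fun K c by apply: measurable_funS mc => //; exact: open_measurable.
by have /integrableP[] := integrable_mul_bounded _ _ _ _ mK iK mcK cM.
Qed.

Lemma locally_integrable_mul_supported D K f phi : locally_integrable D f ->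
  K `<=` D -> compact K -> {in D, continuous phi} ->
  (forall x, ~ K x -> phi x = 0) ->
  mu.-integrable D (fun x => (f x * phi x)%:E).
Proof.
move=> fl KD cK cphi phiK; have [mf oD _] := fl.
have mD : measurable D by exact: open_measurable.
have mK := compact_measurable cK.
have fphil := locally_integrableM _ _ _ fl cphi.
have iK := locally_integrable_compact _ _ _ fphil KD cK.
have iT : mu.-integrable setT (EFin \o (fun x => f x * phi x)).
  move: iK; rewrite integrable_mkcond// restrict_EFin.
  congr (mu.-integrable _ (EFin \o _)); apply: restrict_id_out.
  by move=> x Kx /=; rewrite phiK// mulr0.
exact: (@integrableS _ _ _ mu _ _ _ measurableT mD _ iT).
Qed.

End LocallyIntegrable.

Section TestFunctions.
Context {R : realType}.
Implicit Types (phi : R -> R) (D : set R).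

Lemma test_function_smooth D phi : test_function D phi -> smooth phi.
Proof. by case. Qed.

Lemma test_functionS D E phi : D `<=` E -> test_function D phi -> test_function E phi.
Proof. by move=> DE [sp cp pD]; split => //; exact: subset_trans DE. Qed.

Let supp phi := closure [set x | phi x != 0].

Lemma test_function_out phi x : ~ supp phi x -> phi x = 0.
Proof.
move=> px; apply/eqP; apply: contrapT => /negP p0; apply: px.
exact: subset_closure.
Qed.

Lemma test_function_derive1_out phi x : ~ supp phi x -> derive1 phi x = 0.
Proof.
move=> px; rewrite derive1E.
rewrite (@near_eq_derive _ _ _ _ (cst (0 : R))) ?derive_cst//.
have oS : open (~` supp phi) by apply: closed_openC; exact: closed_closure.
have : nbhs x (~` supp phi) by exact: open_nbhs_nbhs.
by apply: filterS => y /test_function_out ->.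
Qed.

End TestFunctions.

Section Representative.
Context {R : realType}.
Local Notation mu := (@lebesgue_measure R).

(** Lebesgue's theorem is applied to the restrictions of [w] to the intervals
    [ ]1/(n+1), n+1[ ], which exhaust the half-line and on which [w] is integrable;
    [E] consists of the Lebesgue points common to all of them. *)
Lemma weak_derivative_representative (w k : R -> R) :
  locally_integrable Rpos w -> locally_integrable Rpos k ->
  (forall phi, test_function Rpos phi ->
     \int[mu]_(x in Rpos) (w x * derive1 phi x) =
     - \int[mu]_(x in Rpos) (k x * phi x)) ->
  exists2 E : set R, {ae mu, forall x, E x} &
    forall a b, E a -> E b -> 0 < a -> a < b ->
      w b - w a = \int[mu]_(x in `]a, b]) k x.
Proof.
move=> wl kl wk.
pose D n : set R := `]n.+1%:R^-1, n.+1%:R[%classic.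
have Dcc n : D n `<=` `[n.+1%:R^-1, n.+1%:R]%classic by exact: subset_itv_oo_cc.
have ccR n : `[n.+1%:R^-1, n.+1%:R]%classic `<=` (Rpos : set R).
  move=> x; rewrite /Rpos/= !in_itv/= andbT => /andP[nx _].
  by rewrite (lt_le_trans _ nx).
have DR n : D n `<=` Rpos := subset_trans (Dcc n) (ccR n).
have mD n : measurable (D n) by exact: measurable_itv.
have iD f n : locally_integrable Rpos f -> mu.-integrable (D n) (EFin \o f).
  move=> fl; have := locally_integrable_compact _ _ _ fl (ccR n) (@segment_compact _ _ _).
  by apply: (@integrableS _ _ _ mu) => //; exact: measurable_itv.
have iT f n : locally_integrable Rpos f -> mu.-integrable setT (EFin \o (f \_ (D n))).
  by move=> fl; rewrite -restrict_EFin -(@integrable_mkcond _ _ _ mu _ _ (mD n)); exact: iD.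
exists [set x | forall n, lebesgue_pt (w \_ (D n)) x].
  apply: ae_foralln => n; apply: lebesgue_differentiation.
  by apply: integrable_locally_restrict => //; exact: iD.
move=> a b Ea Eb a0 ab.
have b0 := lt_trans a0 ab.
pose n := maxn (Num.truncn b) (Num.truncn a^-1).
have bn : b < n.+1%:R.
  by rewrite (lt_le_trans (truncnS_gt b))// ler_nat ltnS leq_maxl.
have an : n.+1%:R^-1 < a.
  rewrite -[a]invrK ltf_pV2 ?posrE ?invr_gt0//.
  by rewrite (lt_le_trans (truncnS_gt a^-1))// ler_nat ltnS leq_maxr.
have aD : D n a by rewrite /D/= in_itv/= an (lt_trans ab).
have bD : D n b by rewrite /D/= in_itv/= bn (lt_trans an).
have wn : (w \_ (D n)) b - (w \_ (D n)) a = \int[mu]_(x in `]a, b]) (k \_ (D n)) x.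
  apply: (@weak_derivative_FTC _ n.+1%:R^-1 n.+1%:R) => //; [exact: iT|exact: iT|].
  move=> phi tphi; have tphi' := test_functionS _ _ _ (DR n) tphi.
  have [_ _ suppD] := tphi.
  have pD x : ~ D n x -> phi x = 0.
    by move=> Dx; apply: test_function_out => /suppD.
  have p'D x : ~ D n x -> derive1 phi x = 0.
    by move=> Dx; apply: test_function_derive1_out => /suppD.
  have restr (f c : R -> R) : (forall x, ~ D n x -> c x = 0) ->
    \int[mu]_x ((f \_ (D n)) x * c x) = \int[mu]_(x in Rpos) (f x * c x).
    move=> cD; rewrite [RHS]Rintegral_mkcond; apply: (@eq_Rintegral _ _ _ mu) => x _.
    rewrite !patchE; case: ifPn => [|/negP xD].
      by rewrite inE => /DR xR; rewrite mem_set.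
    rewrite cD; last by move=> Dx; apply: xD; rewrite inE.
    by rewrite !mulr0; case: ifP.
  by rewrite !restr// wk.
move: wn; rewrite !patchE !mem_set// => ->.
apply: (@eq_Rintegral _ _ _ mu) => x; rewrite inE/= in_itv/= => /andP[ax xb].
by rewrite patchE mem_set// /D/= in_itv/= (lt_trans an)//= (le_lt_trans xb).
Qed.

End Representative.

(** * Integration of the equation *)

Section DalphaFTC.
Context {R : realType}.
Local Notation mu := (@lebesgue_measure R).
Variables (h : R -> R) (alpha : R).
Hypotheses (h_C1 : C1_on `[0, +oo[ h) (h_pos : forall x, 0 < x -> 0 < h x).

Let RposP (x : R) : (x \in (Rpos : set R)) = (0 < x).
Proof. by rewrite mem_setE in_itv/= andbT. Qed.

Let ch : {in Rpos, continuous h}.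
Proof. by move=> x; rewrite RposP => x0; exact: C1_on_continuous x0. Qed.

Let ch' : {in Rpos, continuous (derive1 h)}.
Proof. by move=> x; rewrite RposP => x0; exact: C1_on_continuous_derive1 x0. Qed.

(** The product rule [(h phi)' = h' phi + h phi'] is applied to the test function;
    all three terms are integrable because [phi] has compact support. *)
Lemma Dalpha_weak_derivative (u g phi : R -> R) :
  locally_integrable Rpos u -> Dalpha_is h alpha u g -> test_function Rpos phi ->
  \int[mu]_(x in Rpos) (h x * u x * derive1 phi x) =
  - \int[mu]_(x in Rpos) ((g x + (1 - alpha) * (derive1 h x * u x)) * phi x).
Proof.
move=> ul [gl ug] tphi; have := ug _ tphi; rewrite /Dalpha.
have sphi := test_function_smooth _ _ tphi.
have cphi : {in Rpos, continuous phi}.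
  by move=> x _; exact: smooth_continuous.
have cphi' : {in Rpos, continuous (derive1 phi)}.
  by move=> x _; exact: smooth_continuous (smooth_derive1 _ sphi) x.
have [_ cK KR] := tphi.
have mR : measurable (Rpos : set R) by exact: measurable_itv.
have ihu : mu.-integrable Rpos (fun x => (u x * h x * derive1 phi x)%:E).
  apply: (locally_integrable_mul_supported _ _ _ _ _ KR cK cphi').
    exact: locally_integrableM.
  exact: test_function_derive1_out.
have ihu' : mu.-integrable Rpos (fun x => (u x * derive1 h x * phi x)%:E).
  apply: (locally_integrable_mul_supported _ _ _ _ _ KR cK cphi).
    exact: locally_integrableM.
  exact: test_function_out.
have ig : mu.-integrable Rpos (fun x => (g x * phi x)%:E).
  apply: (locally_integrable_mul_supported _ _ _ _ gl KR cK cphi).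
  exact: test_function_out.
pose A := \int[mu]_(x in Rpos) (u x * h x * derive1 phi x).
pose B := \int[mu]_(x in Rpos) (u x * derive1 h x * phi x).
have -> : \int[mu]_(x in Rpos) (u x * derive1 (h \* phi) x) = B + A.
  rewrite /A /B -(@RintegralD _ _ _ mu _ _ _ mR ihu' ihu).
  apply: (@eq_Rintegral _ _ _ mu) => x; rewrite RposP => x0.
  have dh := C1_on_derive1 _ _ h_C1 x0.
  have dphi : is_derive x 1 phi (derive1 phi x).
    by rewrite derive1E; apply: derivableP; exact: (sphi 0%N).
  have dM := is_deriveM dh dphi.
  have -> : derive1 (h \* phi) x = h x * derive1 phi x + phi x * derive1 h x.
    by rewrite derive1E; exact: (@derive_val _ _ _ _ _ _ _ dM).
  by ring.
have -> : \int[mu]_(x in Rpos) (derive1 h x * u x * phi x) = B.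
  by apply: (@eq_Rintegral _ _ _ mu) => x _; ring.
have -> : \int[mu]_(x in Rpos) (h x * u x * derive1 phi x) = A.
  by apply: (@eq_Rintegral _ _ _ mu) => x _; ring.
have ialpha : mu.-integrable Rpos (fun x => ((1 - alpha) * (u x * derive1 h x * phi x))%:E).
  exact: (@integrableZl _ _ _ mu _ mR (1 - alpha) _ ihu').
have -> : \int[mu]_(x in Rpos) ((g x + (1 - alpha) * (derive1 h x * u x)) * phi x) =
    \int[mu]_(x in Rpos) (g x * phi x) + (1 - alpha) * B.
  rewrite -(@RintegralZl _ _ _ mu _ _ _ mR ihu').
  rewrite -(@RintegralD _ _ _ mu _ _ _ mR ig ialpha).
  by apply: (@eq_Rintegral _ _ _ mu) => x _; ring.
by move=> <-; ring.
Qed.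

Lemma is_derive_powR_comp (r x : R) : 0 < x ->
  is_derive x 1 (fun y => h y `^ r) (r * h x `^ (r - 1) * derive1 h x).
Proof.
move=> x0; have d1 := is_derive1_powR r (h_pos x x0).
have d2 := C1_on_derive1 _ _ h_C1 x0.
exact: (@is_derive1_comp _ (fun y => y `^ r) h).
Qed.

Lemma continuous_powR_comp (r x : R) : 0 < x -> {for x, continuous (fun y => h y `^ r)}.
Proof.
by move=> x0; have [/derivable1_diffP/differentiable_continuous] := is_derive_powR_comp r x x0.
Qed.

(** The product rule for [w = h u] and [m = h^(alpha-1)]: in [m' w + m k] the terms
    with [h' u] cancel and [h^(alpha-1) g] remains. *)
Lemma Dalpha_FTC (u g : R -> R) :
  locally_integrable Rpos u -> Dalpha_is h alpha u g ->
  exists2 E : set R, {ae mu, forall x, E x} &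
    forall a b, E a -> E b -> 0 < a -> a < b ->
      h b `^ alpha * u b - h a `^ alpha * u a =
      \int[mu]_(x in `]a, b]) (h x `^ (alpha - 1) * g x).
Proof.
move=> ul ug; have [gl _] := ug.
pose w x := u x * h x; pose k x := g x + u x * ((1 - alpha) * derive1 h x).
have wl : locally_integrable Rpos w by exact: locally_integrableM.
have kl : locally_integrable Rpos k.
  apply: locally_integrableD => //; apply: locally_integrableM => // x xR.
  by apply: cvgM; [exact: cvg_cst|exact: ch'].
have wk phi : test_function Rpos phi ->
     \int[mu]_(x in Rpos) (w x * derive1 phi x) =
     - \int[mu]_(x in Rpos) (k x * phi x).
  move=> tphi; have := Dalpha_weak_derivative u g phi ul ug tphi => E.
  transitivity (\int[mu]_(x in Rpos) (h x * u x * derive1 phi x)).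
    by apply: (@eq_Rintegral _ _ _ mu) => x _; rewrite /w; ring.
  by rewrite E; congr (- _); apply: (@eq_Rintegral _ _ _ mu) => x _; rewrite /k; ring.
have [E aeE EP] := weak_derivative_representative _ _ wl kl wk.
exists E => // a b Ea Eb a0 ab; have b0 := lt_trans a0 ab.
pose m x := h x `^ (alpha - 1).
pose m' x := (alpha - 1) * h x `^ (alpha - 1 - 1) * derive1 h x.
have abR : `[a, b]%classic `<=` (Rpos : set R).
  by move=> x; rewrite /Rpos/= !in_itv/= andbT => /andP[ax _]; exact: lt_le_trans ax.
have sI : `]a, b]%classic `<=` (`[a, b]%classic : set R) by exact: subset_itv_oc_cc.
have ik : mu.-integrable `]a, b] (EFin \o k).
  have := locally_integrable_compact _ _ _ kl abR (@segment_compact _ a b).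
  by apply: (@integrableS _ _ _ mu) => //; exact: measurable_itv.
have mw : measurable_fun `]a, b] w.
  have [mw oR _] := wl; apply: measurable_funS mw; first exact: open_measurable.
  exact: subset_trans abR.
have dm x : a <= x <= b -> is_derive x 1 m (m' x).
  by move=> /andP[ax _]; apply: is_derive_powR_comp; exact: lt_le_trans ax.
have cm' : {within `[a, b], continuous m'}.
  apply: continuous_in_subspaceT => x; rewrite inE => /abR xR.
  have x0 : 0 < x by rewrite -RposP inE.
  apply: cvgM; last by apply: ch'; rewrite inE.
  by apply: cvgM; [exact: cvg_cst|exact: continuous_powR_comp].
have ae_wk : {ae mu, forall x, a < x <= b -> w x - w a = \int[mu]_(y in `]a, x]) k y}.
  move: aeE; apply: (@filterS _ _ (ae_filter_ringOfSetsType mu)).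
  by move=> x Ex /andP[ax _]; exact: EP.
have := FTC_product_rule _ _ _ _ _ _ ab ik mw dm cm' ae_wk (EP _ _ Ea Eb a0 ab).
have hh r x : 0 < x -> h x `^ (r - 1) * h x = h x `^ r.
  move=> x0; have hx0 := h_pos x x0.
  rewrite -[X in _ * X](powRr1 (ltW hx0)) -powRD ?subrK//.
  by rewrite (gt_eqF hx0) implybT.
have hE x : 0 < x -> m x * w x = h x `^ alpha * u x.
  by move=> x0; rewrite -(hh _ _ x0) /m /w; ring.
rewrite !hE// => ->; apply: (@eq_Rintegral _ _ _ mu) => x.
rewrite inE => /sI/abR xR; have x0 : 0 < x by rewrite -RposP inE.
rewrite /m' /m /w /k -(hh (alpha - 1) _ x0).
move: (h x `^ (alpha - 1 - 1)) => y.
by ring.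
Qed.

End DalphaFTC.

(** * The essential support *)

Section EssentialSupport.
Context {R : realType}.
Local Notation mu := (@lebesgue_measure R).

(** Lindelof's argument: every point outside the support lies in an interval
    with rational ends on which [u] vanishes a.e., and there are countably many
    of those. *)
Lemma ess_support_null (D : set R) (u : R -> R) :
  {ae mu, forall y, D y -> ~ ess_support D u y -> u y = 0}.
Proof.
pose Q n : set R := if unpickle n is Some pq then
  `](ratr (pq : rat * rat).1 : R), (ratr pq.2 : R)[%classic else set0.
pose null V := {ae mu, forall y, D y -> V y -> u y = 0}.
have aeQ : {ae mu, forall y, forall n, null (Q n) -> D y -> Q n y -> u y = 0}.
  apply: ae_foralln => n; have [nQ|nQ] := pselect (null (Q n)).
    by move: nQ; apply: (@filterS _ _ (ae_filter_ringOfSetsType mu)) => y uy _.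
  exact: aeW.
move: aeQ; apply: (@filterS _ _ (ae_filter_ringOfSetsType mu)) => y uy Dy ysupp.
have [V yV nV] : exists2 V, nbhs y V & null V.
  by apply: contrapT => nV; apply: ysupp => V yV nullV; apply: nV; exists V.
have /nbhs_ballP[e /= e0 eV] := yV.
have /rat_in_itvoo[p py] : y - e < y by rewrite ltrBlDr ltrDl.
have /rat_in_itvoo[q qy] : y < y + e by rewrite ltrDl.
move: py qy; rewrite !in_itv/= => /andP[ep py] /andP[yq qe].
have [n nE] : exists n, unpickle n = Some (p, q) by exists (pickle (p, q)); exact: pickleK.
have QE : Q n = `](ratr p : R), (ratr q : R)[%classic by rewrite /Q nE.
have Qy : Q n y by rewrite QE /= in_itv/= py yq.
apply: (uy n _ Dy Qy).
move: nV; rewrite /null QE.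
apply: (@filterS _ _ (ae_filter_ringOfSetsType mu)) => z uz Dz /= pzq.
apply: uz => //; apply: eV; rewrite /ball/= ltr_norml.
by move: pzq; rewrite in_itv/= => /andP[pz zq]; apply/andP; split; lra.
Qed.

End EssentialSupport.

(** * The pointwise estimate *)

Section Logarithm.
Context {R : realType}.
Local Notation mu := (@lebesgue_measure R).

Lemma measurable_inv_Rpos (x : R) : measurable_fun `]0, x] (fun t : R => (t^-1)%:E).
Proof.
have sR : `]0, x] `<=` (Rpos : set R).
  by move=> t; rewrite /Rpos/= !in_itv/= andbT => /andP[].
apply/measurable_EFinP; apply: (measurable_funS _ sR); first exact: measurable_itv.
apply: open_continuous_measurable_fun; first exact: interval_open.
move=> t; rewrite mem_setE in_itv/= andbT => t0.
by apply: inv_continuous; rewrite gt_eqF.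
Qed.

Lemma integral_inv_0 (x : R) : 0 < x -> (\int[mu]_(t in `]0%R, x]) (t^-1)%:E = +oo)%E.
Proof.
move=> x0; apply: eq_infty => N.
have [N0|N0] := leP N 0.
  apply: (@le_trans _ _ 0%E); first by rewrite lee_fin.
  by apply: integral_ge0 => t /=; rewrite in_itv/= => /andP[t0 _]; rewrite lee_fin invr_ge0 ltW.
pose e := x * expR (- N).
have e0 : 0 < e by rewrite mulr_gt0 ?expR_gt0.
have ex : e <= x by rewrite ger_pMr// expRN invf_le1 ?expR_gt0// ltW// expR_gt1.
have d t : e <= t <= x -> is_derive t 1 (@ln R) t^-1.
  by move=> /andP[et _]; exact: is_derive1_ln (lt_le_trans e0 et).
have cV : {within `[e, x], continuous (fun t : R => t^-1)}.
  apply: continuous_in_subspaceT => t; rewrite inE/= in_itv/= => /andP[et _].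
  by apply: inv_continuous; rewrite gt_eqF// (lt_le_trans e0).
have := FTC2_is_derive _ _ _ _ ex d cV.
rewrite /e lnM ?posrE ?expR_gt0// expRK opprD opprK addrA subrr add0r => <-.
have mV := measurable_inv_Rpos x.
apply: (@ge0_subset_integral _ _ _ mu _ _ (measurable_itv _) (measurable_itv _)) => //.
- by move=> t /=; rewrite in_itv/= => /andP[t0 _]; rewrite lee_fin invr_ge0 ltW.
- by move=> t /=; rewrite !in_itv/= => /andP[et ->]; rewrite andbT (lt_le_trans e0).
Qed.

End Logarithm.

Section MainEstimate.
Context {R : realType}.
Local Notation mu := (@lebesgue_measure R).
Variables (h : R -> R) (alpha sigma X C K1 K2 : R).
Hypotheses (h_C1 : C1_on `[0, +oo[ h) (h_pos : forall x, 0 < x -> 0 < h x)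
  (X0 : 0 < X) (C0 : 0 < C) (K10 : 0 < K1).
Let s := alpha - sigma.
Hypotheses (h_le : forall x, 0 < x <= X -> h x <= C * x)
  (hK1 : forall x, 0 < x <= X -> h x `^ (s - 1) <= K1 * x `^ (s - 1))
  (hK2 : forall x, 0 < x <= X -> h x `^ (- s) <= K2 * x `^ (- s)).
Variables (u g : R -> R) (E : set R).
Hypotheses (gl : locally_integrable Rpos g)
  (aeE : {ae mu, forall x, E x})
  (EP : forall a b, E a -> E b -> 0 < a -> a < b ->
      h b `^ alpha * u b - h a `^ alpha * u a =
      \int[mu]_(x in `]a, b]) (h x `^ (alpha - 1) * g x)).
Let G := (weighted h sigma g) \_ Rpos.
Hypothesis (mG : measurable_fun setT G).
Let v x := h x `^ alpha * u x.

Let powR_hD (x r r' : R) : 0 < x -> h x `^ (r + r') = h x `^ r * h x `^ r'.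
Proof. by move=> x0; rewrite powRD// (gt_eqF (h_pos _ x0)) implybT. Qed.

(** [h^(alpha-1) |g| = h^(s-1) |h^sigma g|], and [h^(s-1)] is comparable to
    [x^(s-1)]. *)
Lemma increment_le a b : E a -> E b -> 0 < a -> a < b -> b <= X ->
  (`|v b - v a|%:E <= K1%:E * hardy_primitive s G b)%E.
Proof.
move=> Ea Eb a0 ab bX; rewrite /v EP//.
have b0 := lt_trans a0 ab.
have mab : measurable (`]a, b]%classic : set R) by exact: measurable_itv.
have m0b : measurable (`]0, b]%classic : set R) by exact: measurable_itv.
have abR : `[a, b]%classic `<=` (Rpos : set R).
  by move=> x; rewrite /Rpos/= !in_itv/= andbT => /andP[ax _]; exact: lt_le_trans ax.
have ihg : mu.-integrable `]a, b] (fun x => (h x `^ (alpha - 1) * g x)%:E).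
  have hgl : locally_integrable Rpos (g \* (fun x => h x `^ (alpha - 1))).
    apply: locally_integrableM => // x; rewrite mem_setE in_itv/= andbT => x0.
    exact: continuous_powR_comp.
  have := locally_integrable_compact _ _ _ hgl abR (@segment_compact _ a b).
  move=> /(@integrableS _ _ _ mu _ `]a, b] _ (measurable_itv _) mab) ih.
  apply: (@eq_integrable _ _ _ mu _ mab _ _ _ (ih _)); last exact: subset_itv_oc_cc.
  by move=> x _ /=; rewrite mulrC.
have mhp : measurable_fun setT (fun x => x `^ (s - 1) * `|G x|).
  by apply: measurable_funM; [exact: measurable_powR|exact: measurableT_comp].
rewrite EFin_normr_Rintegral//.
apply: (le_trans (@le_abse_integral _ _ _ mu _ _ mab (measurable_int mu ihg))).
apply: (@le_trans _ _ (\int[mu]_(x in `]a, b]) (K1%:E * (x `^ (s - 1) * `|G x|)%:E))%E).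
  apply: (@ge0_le_integral _ _ _ mu _ mab) => //.
  - by apply: measurableT_comp => //; have /integrableP[] := ihg.
  - apply: emeasurable_funM; first exact: measurable_cst.
    exact/measurable_EFinP/measurable_funTS.
  move=> x /=; rewrite in_itv/= => /andP[ax xb].
  have x0 := lt_trans a0 ax.
  have -> : alpha - 1 = s - 1 + sigma by rewrite /s; ring.
  rewrite powR_hD// -mulrA normrM -EFinM lee_fin mulrA.
  rewrite ger0_norm ?powR_ge0//; apply: ler_pM; rewrite ?powR_ge0 ?normr_ge0//.
    by apply: hK1; rewrite x0 (le_trans xb).
  by rewrite /G patchE mem_set// /Rpos/= in_itv/= x0.
rewrite ge0_integralZl//; last 3 first.
- exact/measurable_EFinP/measurable_funTS.
- by move=> x _; rewrite lee_fin mulr_ge0 ?powR_ge0.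
- by rewrite lee_fin ltW.
apply: lee_wpmul2l; first by rewrite lee_fin ltW.
apply: ge0_subset_integral => //.
- exact/measurable_EFinP/measurable_funTS.
- by move=> x _; rewrite lee_fin mulr_ge0 ?powR_ge0.
- by move=> x /=; rewrite !in_itv/= => /andP[ax ->]; rewrite (lt_trans a0).
Qed.

(** This is where the integrability of [h^sigma1 u] enters.  With
    [y = (alpha - sigma1) q >= 1], the function [|h^sigma1 u|^q = h^(-y) |v|^q]
    dominates a multiple of [h^(-1)], hence of [1/t], as [h] is bounded by a multiple of [t]. *)
Lemma integrable_not_bounded_below (q sigma1 e x : R) : 0 < q -> 1 <= (alpha - sigma1) * q ->
  Lp_Rpos q%:E (weighted h sigma1 u) -> 0 < x <= X -> 0 < e ->
  (forall a, E a -> 0 < a <= x -> e <= `|v a|) -> False.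
Proof.
move=> q0 gamma1 uq /andP[x0 xX] e0 ev.
pose f := (weighted h sigma1 u) \_ Rpos.
have {}uq : f \in Lfun mu q%:E := uq.
have [mf lf] : measurable_fun setT f /\ (\int[mu]_t (`|(EFin \o f) t| `^ q) < +oo)%E.
  move: uq; rewrite inE => /andP[/[!inE]/= mf lpf]; split => //.
  have <- := @poweR_Lnorm _ _ _ mu (EFin \o f) q (lt0r_neq0 q0).
  exact: poweR_lty.
have [M M0 ME] : exists2 M, 0 < M & M = C * X by exists (C * X); rewrite ?mulr_gt0.
set y := (alpha - sigma1) * q in gamma1.
pose e' := e `^ q * M `^ (1 - y) / C.
have e'0 : 0 < e' by rewrite divr_gt0 ?mulr_gt0 ?powR_gt0.
have m0x : measurable (`]0, x]%classic : set R) by exact: measurable_itv.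
have mfq : measurable_fun setT (fun t => (`|(EFin \o f) t| `^ q)%E).
  by apply: measurable_abse_poweR; exact/measurable_EFinP.
have : (\int[mu]_(t in `]0%R, x]) (e'%:E * (t^-1)%:E) <=
        \int[mu]_t (`|(EFin \o f) t| `^ q))%E.
  apply: (@le_trans _ _ (\int[mu]_(t in `]0%R, x]) (`|(EFin \o f) t| `^ q))%E); last first.
    by apply: ge0_subset_integral => // t _; exact: poweR_ge0.
  apply: (@ae_ge0_le_integral _ _ _ mu _ m0x).
  - move=> t /=; rewrite in_itv/= => /andP[t0 _].
    by rewrite -EFinM lee_fin mulr_ge0// ?invr_ge0 ltW.
  - apply: emeasurable_funM; first exact: measurable_cst.
    exact: measurable_inv_Rpos.
  - by move=> t _; exact: poweR_ge0.
  - exact: measurable_funTS.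
  move: aeE; apply: (@filterS _ _ (ae_filter_ringOfSetsType mu)) => t Et /=.
  rewrite in_itv/= => /andP[t0 tx]; have ht0 := h_pos _ t0.
  have hC : h t <= C * t by apply: h_le; rewrite t0 (le_trans tx).
  have hM : h t <= M.
    by rewrite ME (le_trans hC)// ler_wpM2l ?(ltW C0)// (le_trans tx).
  rewrite -EFinM ?poweR_EFin lee_fin /f patchE mem_set; last first.
    by rewrite /Rpos/= in_itv/= t0.
  have -> : weighted h sigma1 u t = h t `^ (sigma1 - alpha) * v t.
    by rewrite /weighted /v mulrA -powR_hD// subrK.
  rewrite normrM ger0_norm ?powR_ge0// powRM ?powR_ge0// -powRrM.
  have -> : (sigma1 - alpha) * q = - y by rewrite /y; ring.
  have -> : e' * t^-1 = M `^ (1 - y) / (C * t) * e `^ q.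
    by rewrite /e'; field; rewrite !gt_eqF.
  apply: ler_pM; rewrite ?powR_ge0 ?mulr_ge0 ?invr_ge0 ?mulr_ge0 ?powR_ge0 ?(ltW C0) ?(ltW t0)//.
    (* Powers of [h / M], which is at most [1], decrease with the exponent. *)
    have hM1 : 0 < h t / M <= 1 by rewrite divr_gt0//= ler_pdivrMr// mul1r.
    have y1 : - y <= -1 by rewrite lerN2.
    have := ger_powR hM1 y1.
    rewrite !powRM ?invr_ge0 ?(ltW ht0) ?(ltW M0)// -!(powR_inv1 (ltW M0)) -!powRrM.
    rewrite !mulN1r !opprK powRr1 ?(ltW M0)// => hy.
    apply: (@le_trans _ _ (h t `^ (-1) * M * M `^ (- y))).
      rewrite powRD ?(gt_eqF M0) ?implybT// powRr1 ?(ltW M0)// mulrC mulrA.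
      rewrite -!mulrA ler_wpM2r ?mulr_ge0 ?powR_ge0 ?(ltW M0)//.
      by rewrite powR_inv1 ?(ltW ht0)// lef_pV2 ?posrE ?mulr_gt0.
    apply: (le_trans (ler_wpM2r (powR_ge0 _ _) hy)).
    by rewrite -mulrA -powRD ?subrr ?powRr0 ?mulr1// (gt_eqF M0) implybT.
  apply: ge0_ler_powR; rewrite ?nnegrE ?(ltW q0) ?(ltW e0)//.
  by apply: ev => //; rewrite t0.
rewrite ge0_integralZl//; last 3 first.
- exact: measurable_inv_Rpos.
- by move=> t /=; rewrite in_itv/= => /andP[t0 _]; rewrite lee_fin invr_ge0 ltW.
- by rewrite lee_fin ltW.
rewrite integral_inv_0// gt0_muley ?lte_fin// leye_eq => /eqP foo.
by move: lf; rewrite foo ltxx.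
Qed.

(** If this failed at [x], the increment bound would keep [|v|] above
    [|v x| - K1 A x > 0] on all of [ ]0, x[ ]; when [A x] is infinite there is
    nothing to prove. *)
Lemma v_le_hardy_primitive (q sigma1 x : R) : 0 < q -> 1 <= (alpha - sigma1) * q ->
  Lp_Rpos q%:E (weighted h sigma1 u) -> E x -> 0 < x <= X ->
  (`|v x|%:E <= K1%:E * hardy_primitive s G x)%E.
Proof.
move=> q0 y1 uq Ex /andP[x0 xX]; rewrite leNgt; apply/negP => vx.
have hp0 := hardy_primitive_ge0 s G x.
have hfin : hardy_primitive s G x \is a fin_num.
  rewrite ge0_fin_numE// ltey; apply/eqP => hy; move: vx.
  by rewrite hy gt0_muley ?lte_fin.
move: vx; rewrite -(fineK hfin) -EFinM lte_fin -subr_gt0.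
set e := _ - _ => e0.
have x2 : 0 < x / 2 <= X.
  by rewrite divr_gt0//= (le_trans _ xX)// ler_pdivrMr// ler_peMr ?ler1n// ltW.
apply: (integrable_not_bounded_below _ _ _ _ q0 y1 uq x2 e0) => a Ea /andP[a0 ax].
have ax' : a < x by rewrite (le_lt_trans ax)// ltr_pdivrMr// ltr_pMr// ltr1n.
have := increment_le _ _ Ea Ex a0 ax' xX.
rewrite -(fineK hfin) -EFinM lee_fin => va.
rewrite /e lerBlDr; have := ler_normD (v x - v a) (v a); rewrite subrK => h1.
by rewrite (le_trans h1)// addrC lerD2l.
Qed.

Lemma weighted_le_hardy_average (q sigma1 x : R) : 0 < q -> 1 <= (alpha - sigma1) * q ->
  Lp_Rpos q%:E (weighted h sigma1 u) -> E x -> 0 < x <= X ->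
  (`|weighted h sigma u x|%:E <= (K2 * K1)%:E * hardy_average s G x)%E.
Proof.
move=> q0 y1 uq Ex /andP[x0 xX].
have xX' : 0 < x <= X by rewrite x0.
have -> : weighted h sigma u x = h x `^ (- s) * v x.
  by rewrite /weighted /v mulrA -powR_hD//; congr (_ `^ _ * _); rewrite /s; ring.
rewrite normrM ger0_norm ?powR_ge0// /hardy_average x0 EFinM.
apply: (@le_trans _ _ ((K2 * x `^ (- s))%:E * (K1%:E * hardy_primitive s G x))%E).
  apply: lee_pmul; rewrite ?lee_fin ?powR_ge0 ?hK2//.
  exact: (v_le_hardy_primitive _ _ _ q0 y1 uq Ex xX').
by rewrite !EFinM muleACA.
Qed.

End MainEstimate.

(** * The weighted norm estimate *)

(** The case [p = 1] would force [q] to be infinite, against [q <= p]. *)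
Lemma conjugate_exponents (R : realType) (p q : \bar R) :
  (1 <= p)%E -> (p^-1 + q^-1 = 1)%E -> (q <= p)%E ->
  (1 < p)%E /\ exists2 r : R, 0 < r & q = r%:E.
Proof.
move=> p1 pq qp; have [pE|pN1] := eqVneq p 1%E.
  exfalso; move: pq qp; rewrite pE inve1.
  case: q => [r| |]//; rewrite inver; case: ifPn => // r0 [] r1 _.
  by have := invr_neq0 r0; rewrite (_ : r^-1 = 0) ?eqxx//; lra.
have {}p1 : (1 < p)%E by rewrite lt_neqAle eq_sym pN1.
split => //.
have pV : (p^-1 < 1)%E.
  move: p1; case: p {pq qp pN1} => [p| |]//; last by rewrite invey lte_fin.
  by rewrite lte_fin => p1; rewrite inver gt_eqF ?(lt_trans _ p1)// lte_fin invf_lt1// (lt_trans _ p1).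
have pV0 : (0 <= p^-1)%E by rewrite inve_ge0 (le_trans _ (ltW p1)).
case: q pq qp => [r| |].
- rewrite inver; case: ifPn => [_|r0].
    by case: (p^-1)%E pV pV0.
  case: (p^-1)%E pV pV0 => [a| |]//; rewrite !lte_fin => a1 a0 [ar] _.
  by exists r => //; rewrite -invr_gt0; lra.
- by rewrite invey adde0 => pE; rewrite pE ltxx in pV.
- by rewrite inveNy addeNy.
Qed.

Theorem proposition5p3 (R : realType) (p q : \bar R) (h : R -> R)
    (alpha sigma X : R)
    (p_ge1 : (1 <= p)%E) (pq : (p^-1 + q^-1 = 1)%E) (q_le_p : (q <= p)%E)
    (h_C1 : C1_on `[0, +oo[ h) (h_bounded : Lp_Rpos +oo%E h)
    (h0 : h 0 = 0) (dh0 : 0 < derive1_within `[0, +oo[ h 0)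
    (h_pos : forall x, 0 < x -> 0 < h x)
    (h_liminf : (0 < limf_einf (EFin \o h) (pinfty_nbhs R))%E)
    (sigma_lt : (sigma%:E < alpha%:E - p^-1)%E)
    (X_pos : 0 < X) :
  exists C : R, forall (u g : R -> R) (sigma1 : R),
    locally_integrable Rpos u ->
    ess_support Rpos u `<=` `[0, X] ->
    Dalpha_is h alpha u g ->
    Lp_Rpos p (weighted h sigma g) ->
    sigma <= sigma1 -> (sigma1%:E <= alpha%:E - q^-1)%E ->
    Lp_Rpos q (weighted h sigma1 u) ->
    Lp_Rpos p (weighted h sigma u) /\
    (normp_Rpos p (weighted h sigma u) <=
       C%:E * normp_Rpos p (weighted h sigma g))%E.
Proof.
have [p1 [r r0 qE]] := conjugate_exponents _ _ _ p_ge1 pq q_le_p.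
have p0 : (0 < p)%E by rewrite (lt_trans _ p1).
pose s := alpha - sigma.
have ps : (p^-1 < s%:E)%E.
  move: sigma_lt; case: (p^-1)%E => [a| |]//; last by rewrite ltNyr.
  by rewrite -EFinB !lte_fin /s => ?; lra.
have [CH CH0 hardyC] := hardy p s p1 ps.
have [c [C [c0 C0 hcC]]] := C1_on_comparable _ _ h_C1 h0 dh0 h_pos X_pos.
have [K1 K10 hK1] := powR_comparable c C (s - 1) c0 C0.
have [K2 K20 hK2] := powR_comparable c C (- s) c0 C0.
exists (K2 * K1 * CH) => u g sigma1 ul suppu ug gp _ sigma1_le uq.
have [gl _] := ug.
have [E aeE EP] := Dalpha_FTC h alpha h_C1 h_pos u g ul ug.
pose G := (weighted h sigma g) \_ Rpos.
have {}gp : G \in Lfun lebesgue_measure p := gp.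
have [mG finG] : measurable_fun setT G /\ (normp_Rpos p (weighted h sigma g) < +oo)%E.
  by move: gp; rewrite inE => /andP[/[!inE]/= mG fG]; split.
pose f := (weighted h sigma u) \_ Rpos.
have mf : measurable_fun setT f.
  have mR : measurable (Rpos : set R) by exact: measurable_itv.
  apply/(measurable_restrictT _ _).1 => //; apply: measurable_funM; last by case: ul.
  apply: open_continuous_measurable_fun; first exact: interval_open.
  move=> x; rewrite mem_setE in_itv/= andbT => x0.
  exact: continuous_powR_comp.
have y1 : 1 <= (alpha - sigma1) * r.
  move: sigma1_le; rewrite qE inver gt_eqF// -EFinB lee_fin => h1.
  by rewrite -ler_pdivrMr// div1r; lra.
have fHA : {ae lebesgue_measure, forall x,
    (`|(EFin \o f) x| <= (K2 * K1)%:E * `|hardy_average s G x|)%E}.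
  have := @filterI _ _ (ae_filter_ringOfSetsType _) _ _ aeE (ess_support_null Rpos u).
  apply: (@filterS _ _ (ae_filter_ringOfSetsType _)) => x /= [Ex ux].
  rewrite gee0_abs ?hardy_average_ge0//.
  have nonneg : (0 <= (K2 * K1)%:E * hardy_average s G x)%E.
    by rewrite mule_ge0 ?hardy_average_ge0// lee_fin mulr_ge0 ?ltW.
  rewrite /f patchE mem_setE in_itv/= andbT; case: ifP => [x0|_]; last by rewrite normr0.
  have [xX|Xx] := leP x X.
    have hK a K : (forall x y, 0 < x -> c * x <= y <= C * x -> y `^ a <= K * x `^ a) ->
        forall x, 0 < x <= X -> h x `^ a <= K * x `^ a.
      by move=> cmp z /andP[z0 zX]; apply: cmp => //; apply: hcC; rewrite z0.
    have hC z : 0 < z <= X -> h z <= C * z by move=> /hcC/andP[].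
    have ur : Lp_Rpos r%:E (weighted h sigma1 u) by rewrite -qE.
    have xX' : 0 < x <= X by rewrite x0.
    exact: (weighted_le_hardy_average h alpha sigma X C K1 K2 h_C1 h_pos X_pos C0 K10
      hC (hK _ _ hK1) (hK _ _ hK2) u g E gl aeE EP mG r sigma1 x r0 y1 ur Ex xX').
  rewrite /weighted ux ?mulr0 ?normr0//; first by rewrite /Rpos/= in_itv/= x0.
  by move=> /suppu /=; rewrite in_itv/= => /andP[_ xX]; move: Xx; rewrite ltNge xX.
have Gid : G \_ Rpos = G.
  by apply: restrict_id_out => x xR; rewrite /G patchE memNset.
have bound : (normp_Rpos p (weighted h sigma u) <=
    (K2 * K1 * CH)%:E * normp_Rpos p (weighted h sigma g))%E.
  have K0 : 0 <= K2 * K1 by rewrite mulr_ge0 ?ltW.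
  have mf' : measurable_fun setT (EFin \o f) by exact/measurable_EFinP.
  apply: (le_trans (Lnorm_ae_le _ _ _ _ p0 K0 mf' (measurable_hardy_average s G mG) fHA)).
  rewrite (EFinM (K2 * K1) CH) -muleA; apply: lee_wpmul2l; first by rewrite lee_fin.
  by have := hardyC G mG; rewrite /normp_Rpos Gid.
split => //.
rewrite /Lp_Rpos inE; apply/andP; split; rewrite inE//=.
apply: (le_lt_trans bound); apply: lte_mul_pinfty => //.
by rewrite lee_fin !mulr_ge0// ltW.
Qed.
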